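(* Let $\dot{x}(t)=X_{0}(x(t))+\sum_{i=1}^{m}u_{i}(t)X_{i}(x(t))$, $u\in\mathcal{U}$, be a control-affine system on a smooth manifold $M$, with trajectories $\varphi(t,x,u)$ and control flow $\Phi$ on $\mathcal{U}\times M$. (i) If $E^{\ast}\subset M$ is a strong chain control set, then $$\mathcal{E}^{\ast}:=\{(u,x)\in\mathcal{U}\times M \mid \varphi(t,x,u)\in E^{\ast}\text{ for all }t\in\mathbb{R}\}$$ is a maximal invariant strongly chain transitive set for the control flow $\Phi$. (ii) Conversely, let $\mathcal{E}^{\ast}\subset\mathcal{U}\times M$ be a (nonvoid) maximal invariant strongly chain transitive set for the control flow $\Phi$. Then $$E^{\ast}:=\{x\in M \mid \exists u\in\mathcal{U}:(u,x)\in\mathcal{E}^{\ast}\}$$ is a strong chain control set.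
   Context: Setting. $X_0,\ldots,X_m$ are smooth vector fields on a smooth manifold $M$; $\Omega\subset\mathbb{R}^m$ is a convex and compact neighborhood of $0$; $\mathcal{U}=\{u\in L^\infty(\mathbb{R},\mathbb{R}^m)\mid u(t)\in\Omega\text{ for almost all }t\}$. It is assumed that for all $u\in\mathcal{U}$ and $x_0\in M$ there is a unique (Carathéodory) solution $\varphi(t,x_0,u)$, $t\in\mathbb{R}$, with $\varphi(0,x_0,u)=x_0$. A metric $d_M$ compatible with the topology of $M$ is fixed. Control flow. $\mathcal{U}$ carries a metric $d_{\mathcal{U}}$ compatible with the weak$^\ast$ topology of $L^\infty(\mathbb{R},\mathbb{R}^m)$ (e.g. $d_{\mathcal U}(u,v)=\sum_{i\ge1}2^{-i}\frac{|\int\langle u-v,y_i\rangle dt|}{1+|\int\langle u-v,y_i\rangle dt|}$ with $\{y_i\}$ countable dense in $L^1(\mathbb{R},\mathbb{R}^m)$), for which $\mathcal{U}$ is compact; $\mathcal{U}\times M$ carries the metric $\max\{d_{\mathcal{U}},d_M\}$. The control flow is the continuous flow $\Phi(t,u,x)=(u(t+\cdot),\varphi(t,x,u))$ on $\mathcal{U}\times M$. Strong chain transitivity for a continuous flow $\phi$ on a metric space $(X,d)$. Let $\mathcal{P}(X)$ be the set of continuous functions $\varepsilon:X\to(0,\infty)$. For $\varepsilon\in\mathcal{P}(X)$, $T>0$, an $(\varepsilon,T)$-chain from $x$ to $y$ consists of $k\ge1$, points $x_0=x,x_1,\ldots,x_k=y$ in $X$ and times $t_0,\ldots,t_{k-1}\ge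 T$ with $d(\phi(t_j,x_j),x_{j+1})<\varepsilon(\phi(t_j,x_j))$ for all $j$. A set $Y\subset X$ is strongly chain transitive if for all $x,y\in Y$, all $T>0$ and all $\varepsilon\in\mathcal{P}(X)$ there is an $(\varepsilon,T)$-chain from $x$ to $y$. Invariant means $\phi(t,Y)\subset Y$ for all $t\in\mathbb{R}$; a maximal invariant strongly chain transitive set is one which is maximal with respect to inclusion among invariant strongly chain transitive sets. Strong chain control sets. For $\varepsilon\in\mathcal{P}(M)$ and $T>0$, a controlled $(\varepsilon,T)$-chain from $x$ to $y$ consists of $k\ge1$, $T_0,\ldots,T_{k-1}\ge T$, $u_0,\ldots,u_{k-1}\in\mathcal{U}$, $x_0=x,x_1,\ldots,x_k=y\in M$ with $d_M(\varphi(T_j,x_j,u_j),x_{j+1})<\varepsilon(\varphi(T_j,x_j,u_j))$ for all $j$. A point $x$ is strongly chain controllable to $y$ if for every $\varepsilon\in\mathcal{P}(M)$ and every $T>0$ there is a controlled $(\varepsilon,T)$-chain from $x$ to $y$. A nonvoid set $E^\ast\subset M$ is a strong chain control set if (1) every $x\in E^\ast$ is strongly chain controllable to every $y\in E^\ast$, (2) for every $x\in E^\ast$ there is $u\in\mathcal{U}$ with $\varphi(t,x,u)\in E^\ast$ for all $t\in\mathbb{R}$, and (3) $E^\ast$ is maximal with properties (1) and (2). *)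

(* Defs.v *)
From HB Require Import structures.
From mathcomp Require Import all_boot all_order all_algebra.
From mathcomp Require Import all_classical all_reals all_analysis.
From mathcomp Require Import measurable_realfun ess_sup_inf.

Set Implicit Arguments.
Unset Strict Implicit.
Unset Printing Implicit Defensive.

Import Order.TTheory GRing.Theory Num.Theory.
Import numFieldNormedType.Exports.

Local Open Scope classical_set_scope.
Local Open Scope ring_scope.

Definition is_metric (R : realType) (X : Type) (d : X -> X -> R) : Prop :=
  [/\ forall x y, d x y = 0 <-> x = y,
      forall x y, d x y = d y x &
      forall x y z, d x z <= d x y + d y z].

Definition compatible_metric (R : realType) (X : topologicalType)
    (d : X -> X -> R) : Prop :=
  is_metric d /\
  forall (x : X) (A : set X),
    nbhs x A <-> exists2 e : R, 0 < e & [set y | d x y < e] `<=` A.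

Definition max_metric (R : realType) (X Y : Type) (dX : X -> X -> R)
    (dY : Y -> Y -> R) (p q : X * Y) : R :=
  Num.max (dX p.1 q.1) (dY p.2 q.2).

Definition positive_continuous (R : realType) (X : topologicalType)
    (eps : X -> R) : Prop :=
  continuous eps /\ forall x, 0 < eps x.

(* Meant for open [W]: all partial derivatives of order at most [k] exist and
   are continuous on [W]. *)
Fixpoint class_Ck (R : realType) (n : nat) (V : normedModType R) (k : nat)
    (W : set 'rV[R]_n) (f : 'rV[R]_n -> V) : Prop :=
  (forall x, W x -> {for x, continuous f}) /\
  match k with
  | 0 => True
  | k'.+1 => forall j : 'I_n,
      (forall x, W x -> derivable f x (delta_mx 0 j)) /\
      class_Ck k' W (fun x => 'D_(delta_mx 0 j) f x)
  end.

Definition smooth_on (R : realType) (n : nat) (V : normedModType R)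
    (W : set 'rV[R]_n) (f : 'rV[R]_n -> V) : Prop :=
  forall k, class_Ck k W f.

(* The maps are total functions; only their values on [chart_dom], resp. on
   the image of [chart_dom], are meaningful. *)
Record chart (R : realType) (n : nat) (M : topologicalType) := Chart {
  chart_dom : set M ;
  chart_map :> M -> 'rV[R]_n ;
  chart_inv : 'rV[R]_n -> M ;
  chart_dom_open : open chart_dom ;
  chart_img_open : open (chart_map @` chart_dom) ;
  chart_mapK : forall x, chart_dom x -> chart_inv (chart_map x) = x ;
  chart_map_continuous : forall x, chart_dom x -> {for x, continuous chart_map} ;
  chart_inv_continuous : forall y, (chart_map @` chart_dom) y ->
    {for y, continuous chart_inv}
}.

(* The smooth structure is the one generated by [atlas]; the atlas need not be
   maximal. *)
Record smooth_manifold (R : realType) (n : nat) (M : topologicalType) :=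
  SmoothManifold {
  atlas : set (chart R n M) ;
  manifold_hausdorff : hausdorff_space M ;
  manifold_second_countable : @second_countable M ;
  atlas_cover : forall x : M, exists2 c, atlas c & chart_dom c x ;
  atlas_smooth : forall c c', atlas c -> atlas c' ->
    smooth_on (c @` (chart_dom c `&` chart_dom c')) (c' \o chart_inv c)
}.

Definition smooth_function (R : realType) (n : nat) (M : topologicalType)
    (S : smooth_manifold R n M) (f : M -> R) : Prop :=
  forall c, atlas S c ->
    smooth_on (c @` chart_dom c) ((f : M -> R^o) \o chart_inv c).

(* Tangent vectors at [p] are the derivations at [p] of the algebra of smooth
   functions; the values of [v] on nonsmooth functions are irrelevant. *)
Definition is_tangent_vector (R : realType) (n : nat) (M : topologicalType)
    (S : smooth_manifold R n M) (p : M) (v : (M -> R) -> R) : Prop :=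
  forall f g : M -> R, smooth_function S f -> smooth_function S g ->
    (forall a : R, v (fun x => a * f x + g x) = a * v f + v g) /\
    v (fun x => f x * g x) = v f * g p + f p * v g.

Record smooth_vector_field (R : realType) (n : nat) (M : topologicalType)
    (S : smooth_manifold R n M) := SmoothVectorField {
  vector_at :> M -> (M -> R) -> R ;
  vector_at_tangent : forall p, is_tangent_vector S p (vector_at p) ;
  vector_at_smooth : forall f, smooth_function S f ->
    smooth_function S (fun p => vector_at p f)
}.

(* The intervals [p i, q i], i < N, are nonoverlapping and listed from left to
   right. *)
Definition absolutely_continuous_on (R : realType) (V : normedModType R)
    (a b : R) (g : R -> V) : Prop :=
  forall e : R, 0 < e -> exists2 del : R, 0 < del &
    forall (N : nat) (p q : nat -> R),
      (forall i, (i < N)%N -> [/\ a <= p i, p i <= q i & q i <= b]) ->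
      (forall i j, (i < j < N)%N -> q i <= p j) ->
      \sum_(i < N) (q i - p i) < del ->
      \sum_(i < N) `|g (q i) - g (p i)| < e.

Definition locally_absolutely_continuous (R : realType) (n : nat)
    (M : topologicalType) (S : smooth_manifold R n M) (x : R -> M) : Prop :=
  continuous x /\
  forall c, atlas S c -> forall a b : R, a <= b ->
    (forall t, a <= t <= b -> chart_dom c (x t)) ->
    absolutely_continuous_on a b (c \o x).

Definition Linfty (R : realType) :=
  LspaceType (@lebesgue_measure R) (leey (1 : \bar R)%E).
Definition L1 (R : realType) :=
  LspaceType (@lebesgue_measure R) (lexx (1 : \bar R)%E).

(* Elements are tuples of almost-everywhere classes, so Leibniz equality is
   almost-everywhere equality. *)
Definition Linfty_vec (R : realType) (m : nat) := 'I_m -> Linfty R.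
Definition L1_vec (R : realType) (m : nat) := 'I_m -> L1 R.

(* Value at [t] of the chosen representative of the class [u]. *)
Definition vec_at (R : realType) (m : nat) (u : Linfty_vec R m) (t : R) :
  'rV[R]_m := \row_i (u i : R -> R) t.

Definition pre_control (R : realType) (m : nat) (Omega : set 'rV[R]_m) : Type :=
  {u : Linfty_vec R m | \forall t \ae @lebesgue_measure R, Omega (vec_at u t)}.

HB.instance Definition _ (R : realType) (m : nat) (Omega : set 'rV[R]_m) :=
  gen_eqMixin (pre_control Omega).
HB.instance Definition _ (R : realType) (m : nat) (Omega : set 'rV[R]_m) :=
  gen_choiceMixin (pre_control Omega).

Definition duality_pairing (R : realType) (m : nat) (u : Linfty_vec R m)
    (y : L1_vec R m) : R :=
  \int[@lebesgue_measure R]_(t in [set: R])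
    \sum_(i < m) (u i : R -> R) t * (y i : R -> R) t.

Definition as_functional (R : realType) (m : nat) (Omega : set 'rV[R]_m)
    (u : pre_control Omega) : {ptws L1_vec R m -> R} :=
  duality_pairing (sval u).

(* The set of admissible controls with the trace of the weak* topology. *)
Definition control (R : realType) (m : nat) (Omega : set 'rV[R]_m) : Type :=
  initial_topology (@as_functional R m Omega).

HB.instance Definition _ (R : realType) (m : nat) (Omega : set 'rV[R]_m) :=
  Topological.on (control Omega).

Definition control_at (R : realType) (m : nat) (Omega : set 'rV[R]_m)
    (u : control Omega) (t : R) : 'rV[R]_m := vec_at (sval u) t.

Section Shift.
Context (R : realType).
Local Notation mu := (@lebesgue_measure R).
Local Notation TR := (measurableTypeR R).

Lemma measurable_translation (t : R) :
  measurable_fun [set: TR] (fun s : TR => t + s : TR).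
Proof. exact: measurable_funD. Qed.

Lemma lebesgue_measure_translation (t : R) (A : set TR) :
  measurable A -> pushforward mu (fun s : TR => t + s : TR) A = mu A.
Proof.
move=> mA; apply/esym/lebesgue_measure_unique => //=.
  exact: measurable_translation.
move=> mt _ [[a b]] _ <-; rewrite /pushforward.
rewrite [X in _ = mu X](_ : _ = `]a - t, b - t]%classic); last first.
  by apply/seteqP; split=> s /=; rewrite !in_itv/= ltrBlDl lerBrDl.
rewrite !lebesgue_measure_itv/= !lte_fin ltrD2r.
by case: ifP => // _; rewrite -!EFinD opprB addrA subrK.
Qed.

Lemma ae_translation (t : R) (P : R -> Prop) :
  (\forall s \ae mu, P s) -> \forall s \ae mu, P (t + s).
Proof.
case=> N [mN N0 PN].
exists ((fun s : TR => t + s : TR) @^-1` N).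
split=> [||s /= Ps]; last exact: PN.
- by rewrite -[X in measurable X]setTI; exact: measurable_translation.
- by rewrite -[LHS]/(pushforward mu _ N) lebesgue_measure_translation.
Qed.

Definition shift_fun (t : R) (f : {mfun TR >-> TR}) : TR -> TR :=
  fun s => f (t + s).

Lemma shift_fun_measurable (t : R) (f : {mfun TR >-> TR}) :
  measurable_fun [set: TR] (shift_fun t f).
Proof. exact: (measurableT_comp _ (measurable_translation t)). Qed.

HB.instance Definition _ (t : R) (f : {mfun TR >-> TR}) :=
  isMeasurableFun.Build _ _ TR TR (shift_fun t f) (shift_fun_measurable t f).

Definition shift_class (t : R) (f : {mfun_ mu, TR >-> TR}) :
    {mfun_ mu, TR >-> TR} :=
  \pi_({mfun_ mu, TR >-> TR})%qT (shift_fun t (repr f)).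

Lemma shift_classE (t : R) (f : {mfun_ mu, TR >-> TR}) :
  \forall s \ae mu, (shift_class t f : R -> R) s = (f : R -> R) (t + s).
Proof.
have /eqmodP/asboolP : (repr (shift_class t f) =
    shift_fun t (repr f) %[mod {mfun_ mu, TR >-> TR}])%qT by rewrite reprK.
by apply: filterS => s /(_ I).
Qed.

Lemma shift_class_finite (t : R) (f : Linfty R) :
  finite_norm mu +oo (shift_class t f).
Proof.
have mu0 : (0 < mu [set: TR])%E
  by rewrite -set_itvNyy lebesgue_measure_itv/= addye// ltry.
have := @Lebesgue_finite _ _ _ _ _ _ f.
rewrite /finite_norm unlock mu0 /=; apply: le_lt_trans.
apply/ess_supP.
have fE := shift_classE t f.
have fle := ae_translation t (ess_sup_ge mu (abse \o (EFin \o (f : R -> R)))).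
apply: (@filterS2 _ _ (ae_filter_ringOfSetsType mu) _ _ _ _ fE fle).
by move=> s /= ->.
Qed.

Definition shift_Linfty (t : R) (f : Linfty R) : Linfty R :=
  HB.pack (shift_class t f)
    (isFinLebesgue.Build _ _ _ _ _ _ (shift_class t f) (shift_class_finite t f)).

Lemma shift_LinftyE (t : R) (f : Linfty R) :
  \forall s \ae mu, (shift_Linfty t f : R -> R) s = (f : R -> R) (t + s).
Proof. exact: shift_classE. Qed.

Lemma shift_control_subproof (m : nat) (Omega : set 'rV[R]_m) (t : R)
    (u : control Omega) :
  \forall s \ae mu, Omega (vec_at (fun i => shift_Linfty t (sval u i)) s).
Proof.
have H : \forall s \ae mu, forall i : 'I_m,
    (shift_Linfty t (sval u i) : R -> R) s = (sval u i : R -> R) (t + s).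
  by apply: filter_forall => i; exact: shift_LinftyE.
have Ou := ae_translation t (svalP u).
apply: (@filterS2 _ _ (ae_filter_ringOfSetsType mu) _ _ _ _ H Ou).
move=> s Hs; congr Omega.
by apply/rowP => i; rewrite !mxE Hs.
Qed.

Definition shift_control (m : nat) (Omega : set 'rV[R]_m) (t : R)
    (u : control Omega) : control Omega :=
  exist _ (fun i => shift_Linfty t (sval u i)) (shift_control_subproof t u).

Lemma shift_controlE (m : nat) (Omega : set 'rV[R]_m) (t : R)
    (u : control Omega) :
  \forall s \ae mu, control_at (shift_control t u) s = control_at u (t + s).
Proof.
have H : \forall s \ae mu, forall i : 'I_m,
    (shift_Linfty t (sval u i) : R -> R) s = (sval u i : R -> R) (t + s).
  by apply: filter_forall => i; exact: shift_LinftyE.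
apply: (@filterS _ _ (ae_filter_ringOfSetsType mu) _ _ _ H) => s Hs.
by apply/rowP => i; rewrite !mxE Hs.
Qed.

End Shift.

(* Caratheodory solutions of x' = X_0(x) + \sum_i u_i(t) X_i(x): the second
   clause is the equality in the tangent space at [x t], a tangent vector being
   tested on all smooth functions. *)
Definition is_trajectory (R : realType) (n m : nat) (M : topologicalType)
    (S : smooth_manifold R n M) (X0 : smooth_vector_field S)
    (X : 'I_m -> smooth_vector_field S) (Omega : set 'rV[R]_m)
    (u : control Omega) (x : R -> M) : Prop :=
  locally_absolutely_continuous S x /\
  \forall t \ae @lebesgue_measure R, forall f : M -> R, smooth_function S f ->
    is_derive t (1 : R) ((f : M -> R^o) \o x)
      (X0 (x t) f + \sum_(i < m) control_at u t 0 i * X i (x t) f).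

Definition control_flow (R : realType) (m : nat) (M : topologicalType)
    (Omega : set 'rV[R]_m) (phi : R -> M -> control Omega -> M) (t : R)
    (p : control Omega * M) : control Omega * M :=
  (shift_control t p.1, phi t p.2 p.1).

Definition flow_chain (R : realType) (X : Type) (d : X -> X -> R)
    (Phi : R -> X -> X) (eps : X -> R) (T : R) (x y : X) : Prop :=
  exists (k : nat) (z : nat -> X) (s : nat -> R),
    [/\ (0 < k)%N, z 0 = x, z k = y &
      forall j, (j < k)%N ->
        T <= s j /\
        d (Phi (s j) (z j)) (z j.+1) < eps (Phi (s j) (z j))].

Definition strongly_chain_transitive (R : realType) (X : topologicalType)
    (d : X -> X -> R) (Phi : R -> X -> X) (Y : set X) : Prop :=
  forall x y, Y x -> Y y ->
  forall T : R, 0 < T -> forall eps : X -> R, positive_continuous eps ->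
    flow_chain d Phi eps T x y.

Definition flow_invariant (R : realType) (X : Type) (Phi : R -> X -> X)
    (Y : set X) : Prop :=
  forall t, Phi t @` Y `<=` Y.

Definition maximal_for (X : Type) (P : set X -> Prop) (Y : set X) : Prop :=
  P Y /\ forall Z, P Z -> Y `<=` Z -> Z = Y.

Definition maximal_invariant_strongly_chain_transitive (R : realType)
    (X : topologicalType) (d : X -> X -> R) (Phi : R -> X -> X) :
    set X -> Prop :=
  maximal_for (fun Y => flow_invariant Phi Y /\
                        strongly_chain_transitive d Phi Y).

Section ChainControl.
Context (R : realType) (m : nat) (M : topologicalType) (Omega : set 'rV[R]_m).
Variables (d : M -> M -> R) (phi : R -> M -> control Omega -> M).

Definition controlled_chain (eps : M -> R) (T : R) (x y : M) : Prop :=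
  exists (k : nat) (z : nat -> M) (s : nat -> R) (u : nat -> control Omega),
    [/\ (0 < k)%N, z 0 = x, z k = y &
      forall j, (j < k)%N ->
        T <= s j /\
        d (phi (s j) (z j) (u j)) (z j.+1) < eps (phi (s j) (z j) (u j))].

Definition strongly_chain_controllable (x y : M) : Prop :=
  forall eps : M -> R, positive_continuous eps -> forall T : R, 0 < T ->
    controlled_chain eps T x y.

Definition chain_control_property (E : set M) : Prop :=
  (forall x y, E x -> E y -> strongly_chain_controllable x y) /\
  (forall x, E x -> exists u, forall t, E (phi t x u)).

Definition strong_chain_control_set (E : set M) : Prop :=
  E !=set0 /\ maximal_for chain_control_property E.

Definition control_lift (E : set M) : set (control Omega * M) :=
  [set p | forall t, E (phi t p.2 p.1)].

Definition state_projection (E : set (control Omega * M)) : set M :=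
  [set x | exists u, E (u, x)].

End ChainControl.

(* Main.v *)
(* A strongly chain transitive invariant set projects to a set with the chain
   controllability property by testing with functions of the state only. The
   converse is the core of the matter: a controlled chain between two points of
   [E] has to be lifted to a chain of the control flow.

   Concatenate all controls of the chain into one control [w], extended into the
   past and the future by the controls of the two end points. The successive
   shifts of [w] then match exactly, so that the lifted chain jumps in the state
   component only, except for a first and a last jump taking place at fixed
   points; there the control components agree on a window [-N, N], which makes
   them close in the weak* topology once [N] is large. No continuity of the
   trajectories in the control or the initial value is used: only uniqueness,
   which gives the cocycle property and causality.

   The tolerance [eps (u, x)] must be replaced by a tolerance depending on [x]
   only, which is possible because the space of controls is weak* compact. For
   this, the limit of an ultrafilter of controls is a bounded functional on
   integrable functions; weighting it by the Gaussian density turns it into a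
   finite charge, whose Radon-Nikodym derivative divided by the density is the
   limit control. It takes its values in [Omega] almost everywhere because
   [Omega] is cut out by countably many half-spaces. *)

Require Import Defs.
From HB Require Import structures.
From mathcomp Require Import all_boot all_order all_algebra.
From mathcomp Require Import all_classical all_reals all_analysis.
From mathcomp Require Import measurable_realfun ess_sup_inf lra.

Set Implicit Arguments.
Unset Strict Implicit.
Unset Printing Implicit Defensive.

Import Order.TTheory GRing.Theory Num.Theory.
Import numFieldNormedType.Exports.

Local Open Scope classical_set_scope.
Local Open Scope ring_scope.

(** * Admissible controls *)

Lemma ae_imp (R : realType) (P Q : R -> Prop) :
  (\forall t \ae @lebesgue_measure R, P t) -> (forall t, P t -> Q t) ->
  \forall t \ae @lebesgue_measure R, Q t.
Proof.
move=> aP PQ.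
exact: (@filterS _ _ (ae_filter_ringOfSetsType (@lebesgue_measure R)) P Q PQ aP).
Qed.

Lemma ae_imp2 (R : realType) (P Q S : R -> Prop) :
  (\forall t \ae @lebesgue_measure R, P t) ->
  (\forall t \ae @lebesgue_measure R, Q t) ->
  (forall t, P t -> Q t -> S t) -> \forall t \ae @lebesgue_measure R, S t.
Proof.
move=> aP aQ PQS.
exact: (@filterS2 _ _ (ae_filter_ringOfSetsType (@lebesgue_measure R)) _ _ _ PQS aP aQ).
Qed.

(** Almost everywhere equal functions give the same class of the quotient, and the bundled proof of
    finite norm is irrelevant. *)
Lemma Linfty_ext (R : realType) (f g : Linfty R) :
  (\forall t \ae @lebesgue_measure R, (f : R -> R) t = (g : R -> R) t) -> f = g.
Proof.
move: f g => [f [[cf]]] [g [[cg]]] /= fg.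
have E : f = g.
  apply/eqP; rewrite -[f]reprK -[g]reprK; apply/eqP/eqmodP/asboolP.
  by apply: (ae_imp fg).
by subst g; have -> : cf = cg by exact: Prop_irrelevance.
Qed.

Lemma control_ext (R : realType) (m : nat) (Omega : set 'rV[R]_m)
    (u v : control Omega) :
  (\forall t \ae @lebesgue_measure R, control_at u t = control_at v t) -> u = v.
Proof.
case: u v => [u hu] [v hv] uv.
apply: eq_exist; apply/funext => i; apply: Linfty_ext.
apply: (ae_imp uv) => t /rowP/(_ i); by rewrite /control_at/= !mxE.
Qed.

(** The norm of exponent [+oo] is the essential supremum only when the total mass is positive. *)
Lemma lebesgue_measureT_gt0 (R : realType) :
  (0 < @lebesgue_measure R [set: R])%E.
Proof. by rewrite -set_itvNyy lebesgue_measure_itv/= addye// ltry. Qed.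

Lemma Linfty_of_bounded (R : realType) (f : R -> R) (C : R) :
  measurable_fun [set: measurableTypeR R] (f : measurableTypeR R -> measurableTypeR R) ->
  (\forall t \ae @lebesgue_measure R, `|f t| <= C) ->
  exists F : Linfty R, \forall t \ae @lebesgue_measure R, (F : R -> R) t = f t.
Proof.
move=> mf fC.
pose F0 : {mfun measurableTypeR R >-> measurableTypeR R} :=
  HB.pack f (isMeasurableFun.Build _ _ (measurableTypeR R) (measurableTypeR R) f mf).
pose F1 : {mfun_ (@lebesgue_measure R), measurableTypeR R >-> measurableTypeR R} :=
  (\pi_({mfun_ (@lebesgue_measure R), measurableTypeR R >-> measurableTypeR R})
   F0)%qT.
have F1E : \forall t \ae @lebesgue_measure R, (F1 : R -> R) t = f t.
  have /eqmodP/asboolP : (repr F1 = F0 %[mod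
      {mfun_ (@lebesgue_measure R), measurableTypeR R >-> measurableTypeR R}])%qT
    by rewrite reprK.
  by move/ae_imp; apply => s /(_ I).
have F1fin : finite_norm (@lebesgue_measure R) +oo F1.
  rewrite /finite_norm unlock lebesgue_measureT_gt0.
  apply: (@le_lt_trans _ _ C%:E); last exact: ltry.
  apply/ess_supP.
  apply: (ae_imp2 F1E fC) => t /= -> ?.
  by rewrite lee_fin.
pose F : Linfty R := HB.pack F1 (isFinLebesgue.Build _ _ _ _ _ _ F1 F1fin).
by exists F.
Qed.

Lemma normr_coord_le (R : realType) (m : nat) (x : 'rV[R]_m) (i : 'I_m) :
  `|x 0 i| <= `|x|.
Proof.
rewrite [leRHS]/Num.Def.normr/= mx_normrE.
exact: (le_bigmax _ (fun ij => `|x ij.1 ij.2|) (0, i)).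
Qed.

Lemma compact_rV_bounded (R : realType) (m : nat) (A : set 'rV[R]_m) :
  compact A -> exists2 C : R, 0 < C & forall x, A x -> forall i, `|x 0 i| <= C.
Proof.
move=> /compact_bounded [M [_ AM]].
exists (Num.max M 0 + 1); first by rewrite ltr_pwDr// le_max lexx orbT.
move=> x Ax i; apply: (le_trans (normr_coord_le x i)).
by apply: AM => //; rewrite ltr_pwDr// le_max lexx.
Qed.

Lemma ae_forall_ord (R : realType) (m : nat) (P : 'I_m -> R -> Prop) :
  (forall i, \forall t \ae @lebesgue_measure R, P i t) ->
  \forall t \ae @lebesgue_measure R, forall i, P i t.
Proof. by move=> aP; apply: filter_forall. Qed.

(** Compactness of [Omega] bounds every coordinate almost everywhere, which is what membership in
    [Linfty] requires. *)
Lemma control_of (R : realType) (m : nat) (Omega : set 'rV[R]_m)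
    (w : 'I_m -> R -> R) : compact Omega ->
  (forall i, measurable_fun [set: measurableTypeR R]
    (w i : measurableTypeR R -> measurableTypeR R)) ->
  (\forall t \ae @lebesgue_measure R, Omega (\row_i w i t)) ->
  exists u : control Omega,
    \forall t \ae @lebesgue_measure R, control_at u t = \row_i w i t.
Proof.
move=> /compact_rV_bounded [C _ OC] mw Ow.
have /(_ _)/cid-/all_sig[F FE] : forall i, exists F : Linfty R,
    \forall t \ae @lebesgue_measure R, (F : R -> R) t = w i t.
  move=> i; apply: (@Linfty_of_bounded _ _ C (mw i)).
  by apply: (ae_imp Ow) => t /OC/(_ i); rewrite mxE.
have aF := ae_forall_ord FE.
have OF : \forall t \ae @lebesgue_measure R, Omega (vec_at F t).
  apply: (ae_imp2 aF Ow) => t Ft; suff -> : vec_at F t = \row_i w i t by [].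
  by apply/rowP => i; rewrite !mxE.
exists (exist _ F OF); apply: (ae_imp aF) => t Ft.
by apply/rowP => i; rewrite !mxE.
Qed.

Lemma Linfty_measurable (R : realType) (f : Linfty R) :
  measurable_fun [set: measurableTypeR R]
    (f : measurableTypeR R -> measurableTypeR R).
Proof. exact: measurable_funPT. Qed.

Lemma control_at_measurable (R : realType) (m : nat) (Omega : set 'rV[R]_m)
    (u : control Omega) i :
  measurable_fun [set: measurableTypeR R]
    ((fun t => control_at u t 0 i) : measurableTypeR R -> measurableTypeR R).
Proof.
under eq_fun do rewrite mxE; exact: Linfty_measurable.
Qed.

Lemma control_concat (R : realType) (m : nat) (Omega : set 'rV[R]_m) (c : R)
    (u v : control Omega) : compact Omega ->
  exists w : control Omega, \forall t \ae @lebesgue_measure R,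
    control_at w t = if t < c then control_at u t else control_at v t.
Proof.
move=> cO.
pose f i t := if t < c then control_at u t 0 i else control_at v t 0 i.
have fE t : \row_i f i t = if t < c then control_at u t else control_at v t.
  by apply/rowP => i; rewrite mxE /f; case: ifP.
have [i||w wE] := @control_of _ _ Omega f cO.
- apply: measurable_fun_if => //=; last 2 first.
  + by apply: measurable_funTS; exact: control_at_measurable.
  + by apply: measurable_funTS; exact: control_at_measurable.
  exact: measurable_fun_ltr.
- apply: (ae_imp2 (svalP u) (svalP v)) => t ut vt; rewrite fE.
  by case: ifP.
- by exists w; apply: (ae_imp wE) => t ->; exact: fE.
Qed.

Lemma shift_control_comp (R : realType) (m : nat) (Omega : set 'rV[R]_m)
    (s t : R) (u : control Omega) :
  shift_control s (shift_control t u) = shift_control (s + t) u.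
Proof.
apply: control_ext.
have H := shift_controlE s (shift_control t u).
have H1 := ae_translation s (shift_controlE t u).
have H2 := shift_controlE (s + t) u.
apply: (ae_imp2 (ae_imp2 H H1 (fun _ h h1 => conj h h1)) H2) => r [-> ->] ->.
by rewrite addrA [s + t]addrC.
Qed.

Lemma shift_control0 (R : realType) (m : nat) (Omega : set 'rV[R]_m)
    (u : control Omega) : shift_control 0 u = u.
Proof.
apply: control_ext; apply: (ae_imp (shift_controlE 0 u)) => t ->.
by rewrite add0r.
Qed.

(** * Trajectories *)

Lemma absolutely_continuous_on_eq (R : realType) (V : normedModType R) (a b : R)
    (f g : R -> V) : (forall t, a <= t <= b -> f t = g t) ->
  absolutely_continuous_on a b f -> absolutely_continuous_on a b g.
Proof.
move=> fg fac e /fac[del del0 H]; exists del => // N p q apq qp /(H N p q apq qp).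
congr (_ < _); apply: eq_bigr => i _.
have [? ? ?] := apq i (ltn_ord i).
by rewrite !fg//; apply/andP; split=> //; [apply: le_trans; eassumption
  |apply: le_trans; eassumption].
Qed.

Lemma absolutely_continuous_on_shift (R : realType) (V : normedModType R)
    (a b s : R) (f : R -> V) : absolutely_continuous_on (s + a) (s + b) f ->
  absolutely_continuous_on a b (fun t => f (s + t)).
Proof.
move=> fac e /fac[del del0 H]; exists del => // N p q apq qp pqdel.
apply: (H N (fun i => s + p i) (fun i => s + q i)) => [i /apq[? ? ?]|i j /qp ?|].
- by rewrite !lerD2l.
- by rewrite lerD2l.
- apply: le_lt_trans pqdel; apply: ler_sum => i _.
  by rewrite opprD addrACA subrr add0r.
Qed.

(* Clamping the intervals at [c] splits each increment of the glued curve into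
   an increment of [f] and one of [g]. *)
Lemma absolutely_continuous_on_glue (R : realType) (V : normedModType R)
    (a b c : R) (f g : R -> V) : a <= c <= b -> f c = g c ->
  absolutely_continuous_on a c f -> absolutely_continuous_on c b g ->
  absolutely_continuous_on a b (fun t => if t < c then f t else g t).
Proof.
move=> /andP[ac cb] fgc fac gac e e0.
have e20 : 0 < e / 2 by rewrite divr_gt0.
have [d1 d10 H1] := fac _ e20; have [d2 d20 H2] := gac _ e20.
exists (Num.min d1 d2); first by rewrite lt_min d10.
move=> N p q apq qp; rewrite lt_min => /andP[pq1 pq2].
have {}H1 := H1 N (fun i => Num.min (p i) c) (fun i => Num.min (q i) c).
have {}H2 := H2 N (fun i => Num.max (p i) c) (fun i => Num.max (q i) c).
rewrite (splitr e); apply: le_lt_trans (ltrD (H1 _ _ _) (H2 _ _ _)).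
- rewrite -big_split/=; apply: ler_sum => i _.
  have [ap pq qb] := apq i (ltn_ord i).
  (* One of the two clamped arguments is always [c], so the common value [f c = g c] is counted once
     too often. *)
  have E t : (if t < c then f t else g t) =
      f (Num.min t c) + g (Num.max t c) - f c.
    by case: ltP => tc; [rewrite fgc addrK|rewrite [f c + _]addrC addrK].
  rewrite !E; apply: le_trans (ler_normD _ _).
  by rewrite opprB addrA subrK opprD addrACA.
- move=> i /apq[ap pq qb]; split.
  + by rewrite le_min ap ac.
  + by rewrite le_min !ge_min pq lexx orbT.
  + by rewrite ge_min lexx orbT.
- by move=> i j /qp qpij; rewrite le_min !ge_min qpij lexx orbT.
- apply: le_lt_trans pq1; apply: ler_sum => i _.
  have [ap pq qb] := apq i (ltn_ord i).
  by rewrite !minEle; case: ifP => h1; case: ifP => h2; move: h1 h2; lra.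
- move=> i /apq[ap pq qb]; split.
  + by rewrite le_max lexx orbT.
  + by rewrite ge_max !le_max pq lexx orbT.
  + by rewrite ge_max qb cb.
- by move=> i j /qp qpij; rewrite ge_max !le_max qpij lexx orbT.
- apply: le_lt_trans pq2; apply: ler_sum => i _.
  have [ap pq qb] := apq i (ltn_ord i).
  by rewrite !maxEle; case: ifP => h1; case: ifP => h2; move: h1 h2; lra.
Qed.

Section Trajectories.
Context (R : realType) (n m : nat) (M : topologicalType)
  (S : smooth_manifold R n M) (X0 : smooth_vector_field S)
  (X : 'I_m -> smooth_vector_field S) (Omega : set 'rV[R]_m).
Local Notation mu := (@lebesgue_measure R).
Implicit Types (u v w : control Omega) (x y : R -> M).

Lemma continuous_glue (c : R) x y : continuous x -> continuous y -> x c = y c ->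
  continuous (fun t => if t < c then x t else y t).
Proof.
move=> cx cy xyc t A nA.
suff: \forall r \near t, A (if r < c then x r else y r) by [].
have [tc|ct|tc] := ltgtP t c.
- have xA : \forall r \near t, A (x r) by apply: cx; move: nA; rewrite /= tc.
  have lt : \forall r \near t, r < c by exact: lt_nbhsl.
  by apply: filterS2 lt xA => r /= ->.
- have yA : \forall r \near t, A (y r).
    by apply: cy; move: nA; rewrite /= ltNge ltW.
  have lt : \forall r \near t, c < r by exact: lt_nbhsr.
  by apply: filterS2 lt yA => r /= cr; rewrite ltNge ltW.
- rewrite /= tc ltxx in nA; rewrite tc.
  have yA : \forall r \near c, A (y r) by exact: cy.
  have xA : \forall r \near c, A (x r) by apply: cx; rewrite xyc.
  by apply: filterS2 xA yA => r /=; case: ifP.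
Qed.

(** An interval on one side of [c] sees a single curve, up to the common value at [c]. On an
    interval straddling [c], the two coordinate curves in the given chart are glued. *)
Lemma locally_absolutely_continuous_glue (c : R) x y : x c = y c ->
  locally_absolutely_continuous S x -> locally_absolutely_continuous S y ->
  locally_absolutely_continuous S (fun t => if t < c then x t else y t).
Proof.
move=> xyc [cx ax] [cy ay]; split; first exact: continuous_glue.
move=> k Sk a b ab dk.
have [bc|cb] := leP b c.
  apply: (@absolutely_continuous_on_eq _ _ _ _ (k \o x)) => [t /andP[ta tb]/=|].
    case: ltP => // ct; suff -> : t = c by rewrite xyc.
    by apply/eqP; rewrite eq_le ct (le_trans tb).
  apply: ax => // t /[dup] tab /dk; case: ltP => // ct.
  suff -> : t = c by rewrite xyc.
  by apply/eqP; case/andP: tab => _ tb; rewrite eq_le ct (le_trans tb).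
have [ca|ac] := leP c a.
  apply: (@absolutely_continuous_on_eq _ _ _ _ (k \o y)) => [t /andP[ta tb]/=|].
    by rewrite ltNge (le_trans ca).
  by apply: ay => // t /[dup] /andP[ta tb] /dk; rewrite ltNge (le_trans ca).
apply: (@absolutely_continuous_on_eq _ _ _ _
  (fun t => if t < c then (k \o x) t else (k \o y) t)) => [t _/=|].
  by case: ifP.
apply: absolutely_continuous_on_glue; rewrite ?(ltW ac) ?(ltW cb) //=.
- by rewrite xyc.
- apply: ax => //; first exact: ltW.
  move=> t /andP[ta tc]; have := dk t.
  rewrite ta (le_trans tc (ltW cb)) => /(_ isT); case: ltP => // ct.
  suff -> : t = c by rewrite xyc.
  by apply/eqP; rewrite eq_le tc.
- apply: ay => //; first exact: ltW.
  move=> t /andP[ct tb]; have := dk t.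
  by rewrite tb (le_trans (ltW ac) ct) ltNge ct => /(_ isT).
Qed.

(** Exceptional times remain a null set after translation; elsewhere the chain rule applies with
    inner derivative 1. *)
Lemma is_trajectory_shift (s : R) u x : is_trajectory X0 X u x ->
  is_trajectory X0 X (shift_control s u) (fun t => x (s + t)).
Proof.
move=> [[cx ax] dx]; split; [split|].
- move=> t; apply: (@continuous_comp _ _ _ (+%R s) x t); last exact: cx.
  by apply: cvgD; [exact: cvg_cst|exact: cvg_id].
- move=> k Sk a b ab dk; apply: (@absolutely_continuous_on_shift _ _ a b s (k \o x)).
  apply: ax => //; first by rewrite lerD2l.
  move=> t tab; have -> : t = s + (t - s) by rewrite addrC subrK.
  by apply: dk; rewrite lerBrDl lerBlDl.
- apply: (ae_imp2 (ae_translation s dx) (shift_controlE s u)) => t dxt ut f sf.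
  rewrite ut -[X in is_derive _ _ _ X]mulr1.
  apply: (@is_derive1_comp _ (f \o x) (+%R s) t); first exact: dxt.
  rewrite -[X in is_derive _ _ _ X]add0r.
  exact: is_deriveD.
Qed.

Lemma ae_neq (c : R) : \forall t \ae mu, t != c.
Proof.
exists [set c]; split.
- exact: measurable_set1.
- exact: lebesgue_measure_set1.
- by move=> t /= /negP; rewrite negbK => /eqP.
Qed.

(** At each [t != c] the glued curve coincides near [t] with one of the two trajectories and
    inherits its derivative; [c] itself is a null set. *)
Lemma is_trajectory_glue (c : R) u v w x y : x c = y c ->
  is_trajectory X0 X u x -> is_trajectory X0 X v y ->
  (\forall t \ae mu, control_at w t =
     if t < c then control_at u t else control_at v t) ->
  is_trajectory X0 X w (fun t => if t < c then x t else y t).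
Proof.
move=> xyc [lx dx] [ly dy] uvw.
split; first exact: locally_absolutely_continuous_glue.
have H := ae_imp2 dx dy (fun _ h1 h2 => conj h1 h2).
have H' := ae_imp2 uvw (ae_neq c) (fun _ h1 h2 => conj h1 h2).
apply: (ae_imp2 H H') => t [dxt dyt] [-> tc] f sf.
case: ltgtP tc => // tc _.
- apply: near_eq_is_derive (dxt f sf).
  by apply: filterS (lt_nbhsl tc) => r /= ->.
- apply: near_eq_is_derive (dyt f sf).
  by apply: filterS (lt_nbhsr tc) => r /= cr; rewrite ltNge ltW.
Qed.

Variable phi : R -> M -> control Omega -> M.
Hypothesis cOmega : compact Omega.
Hypothesis hsolvable : forall (u : control Omega) (x0 : M),
  exists! x : R -> M, is_trajectory X0 X u x /\ x 0 = x0.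
Hypothesis hphi : forall (u : control Omega) (x0 : M),
  is_trajectory X0 X u (fun t => phi t x0 u) /\ phi 0 x0 u = x0.

Lemma trajectory_uniq u x : is_trajectory X0 X u x ->
  forall t, x t = phi t (x 0) u.
Proof.
move=> ux t; have [z [_ zuniq]] := hsolvable u (x 0).
have xE := etrans (esym (zuniq x (conj ux erefl))) (zuniq _ (hphi u (x 0))).
exact: (congr1 (@^~ t) xE).
Qed.

Lemma flow0 (x0 : M) u : phi 0 x0 u = x0.
Proof. exact: (hphi u x0).2. Qed.

Lemma flow_cocycle s t (x0 : M) u :
  phi (s + t) x0 u = phi t (phi s x0 u) (shift_control s u).
Proof.
have := trajectory_uniq (is_trajectory_shift s (hphi u x0).1) t.
by rewrite addr0.
Qed.

(** Outside [[0, T)] the trajectory of [u] is replaced by pieces driven by [v]. The result is a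
    trajectory of [v] through [x0], so uniqueness identifies it with [phi ^~ x0 v]. *)
Lemma flow_causal (T : R) (x0 : M) u v : 0 <= T ->
  (\forall t \ae mu, 0 <= t < T -> control_at u t = control_at v t) ->
  phi T x0 u = phi T x0 v.
Proof.
move=> T0 uv.
have [w1 w1E] := control_concat T u v cOmega.
have [w wE] := control_concat 0 v w1 cOmega.
have wv : w = v.
  apply: control_ext.
  have H := ae_imp2 uv w1E (fun _ h1 h2 => conj h1 h2).
  apply: (ae_imp2 H wE) => t [uvt w1t] ->.
  case: ltP => // t0; rewrite w1t; case: ltP => // tT; apply: uvt.
  by rewrite t0.
(* After time [T], [y] follows [v] from the point reached by [u]; [z] then corrects the past, where
   [u] and [v] may differ. *)
pose y t := if t < T then phi t x0 u
  else phi (- T + t) (phi T x0 u) (shift_control T v).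
pose z t := if t < 0 then phi t x0 v else y t.
have yT : y T = phi T x0 u by rewrite /y ltxx addNr flow0.
have y0 : y 0 = x0.
  by move: T0; rewrite le_eqVlt => /predU1P[T0|T0];
    [rewrite {1}T0 yT -T0 flow0|rewrite /y T0 flow0].
have ytraj : is_trajectory X0 X w1 y.
  apply: (is_trajectory_glue (u := u) (v := v)) => //.
  - by rewrite addNr flow0.
  - exact: (hphi u x0).1.
  - have := is_trajectory_shift (- T) (hphi (shift_control T v) (phi T x0 u)).1.
    by rewrite shift_control_comp addNr shift_control0.
have ztraj : is_trajectory X0 X v z.
  rewrite -wv; apply: (is_trajectory_glue (u := v) (v := w1)) => //.
  - by rewrite flow0 y0.
  - exact: (hphi v x0).1.
have z0 : z 0 = x0 by rewrite /z ltxx.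
have := trajectory_uniq ztraj T.
by rewrite z0 => <-; rewrite /z ltNge T0 /= yT.
Qed.

End Trajectories.

(** * Bounded functionals on integrable functions *)

Section L1Functional.
Context d (T : measurableType d) (R : realType) (mu : {measure set T -> \bar R}).
Local Notation integrable f := (mu.-integrable [set: T] (EFin \o f)).

Lemma integrable_mulrl (a : R) (f : T -> R) :
  integrable f -> integrable (fun t => a * f t).
Proof.
move=> intf.
rewrite (_ : EFin \o _ = fun t => (a%:E * (EFin \o f) t)%E)//.
exact: integrableZl.
Qed.

Lemma integrable_norm (f : T -> R) :
  integrable f -> integrable (fun t => `|f t|).
Proof. exact: integrable_abse. Qed.

Lemma integrable_measurable (f : T -> R) :
  integrable f -> measurable_fun [set: T] f.
Proof. by move=> intf; exact/measurable_EFinP/measurable_int/intf. Qed.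

Lemma integral_ae_bounded_mul (C : R) (w f : T -> R) : 0 <= C ->
  measurable_fun [set: T] w -> (\forall t \ae mu, `|w t| <= C) ->
  integrable f ->
  (\int[mu]_t `|w t * f t|%:E <= \int[mu]_t (C * `|f t|)%:E)%E.
Proof.
move=> C0 mw wC /integrable_measurable mf.
apply: ae_ge0_le_integral => //.
- by apply/measurable_EFinP/measurableT_comp => //; exact: measurable_funM.
- by move=> t _; rewrite lee_fin mulr_ge0.
- by apply/measurable_EFinP/measurable_funM => //; exact: measurableT_comp.
- move: wC; apply: (@filterS _ _ (ae_filter_ringOfSetsType mu)) => t wtC _ /=.
  by rewrite lee_fin normrM ler_wpM2r.
Qed.

Lemma integrable_ae_bounded_mul (C : R) (w f : T -> R) : 0 <= C ->
  measurable_fun [set: T] w -> (\forall t \ae mu, `|w t| <= C) ->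
  integrable f -> integrable (fun t => w t * f t).
Proof.
move=> C0 mw wC intf; apply/integrableP; split.
  exact/measurable_EFinP/measurable_funM/integrable_measurable.
apply: le_lt_trans (integral_ae_bounded_mul C0 mw wC intf) _.
have /integrableP[_] := integrable_mulrl C (integrable_norm intf).
by under eq_integral do rewrite /= normrM (ger0_norm C0) normr_id.
Qed.

Lemma integrable_indicM (A : set T) (f : T -> R) : measurable A ->
  integrable f -> integrable (fun t => \1_A t * f t).
Proof.
move=> mA intf; apply: (integrable_ae_bounded_mul ler01) => //.
by apply: aeW => t; rewrite indicE; case: (_ \in _); rewrite ?normr1 ?normr0.
Qed.

Lemma le_Rintegral_ae_bounded_mul (C : R) (w f : T -> R) : 0 <= C ->
  measurable_fun [set: T] w -> (\forall t \ae mu, `|w t| <= C) ->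
  integrable f ->
  `|\int[mu]_t (w t * f t)| <= C * \int[mu]_t `|f t|.
Proof.
move=> C0 mw wC intf.
have iwf := integrable_ae_bounded_mul C0 mw wC intf.
apply: (le_trans (le_normr_Rintegral measurableT iwf)).
rewrite -RintegralZl//; last exact: integrable_norm.
rewrite /Rintegral fine_le//.
- by apply: integrable_fin_num => //; exact: integrable_norm.
- by apply: integrable_fin_num => //; exact: integrable_mulrl (integrable_norm _).
- exact: integral_ae_bounded_mul.
Qed.

(** Functionals act on functions, not on classes, and are unconstrained off the integrable ones. The
    bound already forces equal values on integrable functions that agree almost everywhere. *)
Definition L1_functional (C : R) (l : (T -> R) -> R) : Prop :=
  (forall a f g, integrable f -> integrable g ->
     l (fun t => a * f t + g t) = a * l f + l g) /\
  (forall f, integrable f -> `|l f| <= C * \int[mu]_t `|f t|).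

Lemma Rintegral_mul_L1_functional (C : R) (w : T -> R) : 0 <= C ->
  measurable_fun [set: T] w -> (\forall t \ae mu, `|w t| <= C) ->
  L1_functional C (fun f => \int[mu]_t (w t * f t)).
Proof.
move=> C0 mw wC; split => [a f g intf intg|f intf]; last first.
  exact: le_Rintegral_ae_bounded_mul.
have iwf := integrable_ae_bounded_mul C0 mw wC intf.
have iwg := integrable_ae_bounded_mul C0 mw wC intg.
rewrite -RintegralZl// -RintegralD//; last exact: integrable_mulrl.
by apply: eq_Rintegral => t _; rewrite mulrDr mulrCA.
Qed.

Section theory.
Variables (C : R) (l : (T -> R) -> R).
Hypothesis lC : L1_functional C l.

Lemma L1_functional_lin a f g : integrable f -> integrable g ->
  l (fun t => a * f t + g t) = a * l f + l g.
Proof. by move=> *; exact: lC.1. Qed.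

Lemma integrable_cst0 : integrable (fun=> 0).
Proof. exact: integrable0. Qed.

Lemma L1_functional0 : l (fun=> 0) = 0.
Proof.
have := L1_functional_lin 1 integrable_cst0 integrable_cst0.
rewrite (_ : (fun _ => _) = (fun=> 0)); last by apply/funext => t; rewrite mulr0 addr0.
by rewrite mul1r => /eqP; rewrite eq_sym -subr_eq0 addrK => /eqP.
Qed.

Lemma L1_functionalB f g : integrable f -> integrable g ->
  l (fun t => f t - g t) = l f - l g.
Proof.
move=> intf intg; have := L1_functional_lin (-1) intg intf.
rewrite (_ : (fun _ => _) = (fun t => f t - g t)).
  by move=> ->; rewrite mulN1r addrC.
by apply/funext => t; rewrite mulN1r addrC.
Qed.

(** Dominated convergence yields convergence in the L1 norm, and [l] is Lipschitz for that norm. *)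
Lemma L1_functional_cvg (f_ : nat -> T -> R) (f G : T -> R) :
  (forall n, measurable_fun [set: T] (f_ n)) -> measurable_fun [set: T] f ->
  (forall t, f_ ^~ t @ \oo --> f t) -> integrable G ->
  (forall n t, `|f_ n t| <= G t) ->
  l \o f_ @ \oo --> l f.
Proof.
move=> mf_ mf f_f iG f_G.
have if_ n : integrable (f_ n).
  apply: (le_integrable _ _ _ iG) => //; first exact/measurable_EFinP.
  by move=> t _ /=; rewrite lee_fin (le_trans (f_G n t))// ler_norm.
have [|||||intf dist0 _] := @dominated_convergence _ T R mu setT measurableT
    (fun n => EFin \o f_ n) (EFin \o f) (EFin \o G).
- by move=> n; exact/measurable_EFinP.
- exact/measurable_EFinP.
- by apply: aeW => t _; apply: cvg_EFin; [near=> n|exact: f_f].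
- exact: iG.
- by apply: aeW => t n _ /=; rewrite lee_fin.
have {}dist0 : (fun n => C * \int[mu]_t `|f_ n t - f t|) @ \oo --> 0.
  rewrite -[X in _ --> X](mulr0 C); apply: cvgMr.
  exact: (fine_cvg dist0).
apply/cvgrPdist_le => e e0; move/cvgrPdist_le : dist0 => /(_ e e0).
apply: filterS => n; rewrite sub0r normrN => h.
rewrite distrC /= -L1_functionalB//.
apply: le_trans h; apply: le_trans (ler_norm _); apply: lC.2.
exact: (integrableB _ (if_ n) intf).
Unshelve. all: by end_near.
Qed.

End theory.
End L1Functional.

(** * Representation of a weighted functional by a density *)

Section Riesz.
Context d (T : measurableType d) (R : realType)
  (mu : {sigma_finite_measure set T -> \bar R}).
Local Notation integrable f := (mu.-integrable [set: T] (EFin \o f)).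
Variables (g : T -> R) (C : R) (l : (T -> R) -> R).
Hypotheses (g_gt0 : forall t, 0 < g t) (ig : integrable g).
Hypothesis lC : L1_functional mu C l.

Let mg : measurable_fun [set: T] g. Proof. exact: integrable_measurable ig. Qed.

(** The integrable weight [g] gives sense to the charge of sets of infinite measure, whose
    indicators are not integrable. *)
Definition weighted_charge (A : set T) : \bar R :=
  (l (fun t => \1_A t * g t))%:E.

Let charge0 : weighted_charge set0 = 0%E.
Proof.
rewrite /weighted_charge (_ : (fun _ => _) = (fun=> 0)) ?(L1_functional0 lC)//.
by apply/funext => t; rewrite indic0 mul0r.
Qed.

Let charge_finite A : measurable A -> weighted_charge A \is a fin_num.
Proof. by []. Qed.

Let charge_sum (F : (set T)^nat) : (forall i, measurable (F i)) ->
  trivIset setT F -> forall n, (\sum_(0 <= i < n) weighted_charge (F i))%E =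
    weighted_charge (\big[setU/set0]_(i < n) F i).
Proof.
move=> mF tF; elim => [|n IHn].
  by rewrite big_nil big_ord0 charge0.
rewrite big_nat_recr//= IHn big_ord_recr/= /weighted_charge -EFinD.
congr EFin.
have mU : measurable (\big[setU/set0]_(i < n) F i) by exact: bigsetU_measurable.
have := L1_functional_lin lC 1 (integrable_indicM (mF n) ig)
  (integrable_indicM mU ig).
rewrite mul1r addrC => <-.
congr l; apply/funext => t; rewrite mul1r -mulrDl; congr (_ * _).
have tF' : trivIset (fun x => xpredT x) F by exact: sub_trivIset tF.
have /seteqP[+ _] := @trivIset_bigsetUI _ xpredT F tF' n n isT (leqnn _).
move=> /(_ t) dis; rewrite !indicE in_setU.
case: (boolP (t \in F n)) => tn; case: (boolP (t \in \big[setU/set0]_(i < n) F i)) => tU;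
  rewrite /= ?addr0 ?add0r//.
by exfalso; apply: dis; split; apply: set_mem.
Qed.

(** At each point the indicators of the partial unions are eventually constant, and [g] dominates
    their weighted versions. *)
Let charge_sigma_additive : semi_sigma_additive weighted_charge.
Proof.
move=> F mF tF mUF; under eq_fun do rewrite charge_sum//.
apply: cvg_EFin; first by near=> n.
apply: (L1_functional_cvg lC _ _ _ ig) => [n||t|n t].
- by apply: measurable_funM => //; apply: measurable_indic; exact: bigsetU_measurable.
- exact: measurable_funM.
- apply: cvgMl; apply: cvg_near_cst.
  have [[k _ Fkt]|nFt] := pselect ((\bigcup_n F n) t).
    near=> n; rewrite !indicE !mem_set//; first by exists k.
    rewrite -bigcup_mkord; exists k => //=.
    by near: n; exists k.+1.
  near=> n; rewrite !indicE !memNset//.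
  by rewrite -bigcup_mkord => -[k _ Fkt]; apply: nFt; exists k.
- rewrite normrM (gtr0_norm (g_gt0 t)) ler_piMl//; first exact: ltW.
  by rewrite indicE; case: (_ \in _); rewrite ?normr1 ?normr0.
Unshelve. all: by end_near. Qed.

HB.instance Definition _ := isCharge.Build _ T R weighted_charge
  charge0 charge_finite charge_sigma_additive.

Lemma weighted_charge_dominates : weighted_charge `<< mu.
Proof.
apply/null_content_dominatesP => A mA A0.
apply/eqP; rewrite eqe -normr_eq0 eq_le normr_ge0 andbT.
apply: (le_trans (lC.2 _ (integrable_indicM mA ig))).
rewrite (_ : \int[mu]_t _ = 0) ?mulr0// /Rintegral.
rewrite (ae_eq_integral (cst 0%E)) ?integral0//.
- apply/measurable_EFinP/measurableT_comp => //.
  exact: integrable_measurable (integrable_indicM mA ig).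
- exists A; split => // t /= /not_implyP[_]; apply: contra_notP => nAt.
  by rewrite indicE memNset// mul0r normr0.
Qed.

(** The function [h] is the Radon-Nikodym derivative of the charge; the density of [l] itself is
    [h / g], which is formed only later. *)
Lemma weighted_representation : exists h : T -> R, integrable h /\
  forall A, measurable A ->
    l (fun t => \1_A t * g t) = \int[mu]_t (\1_A t * h t).
Proof.
pose f := Radon_Nikodym weighted_charge mu.
have ffin t : f t \is a fin_num.
  exact: Radon_Nikodym_fin_num weighted_charge_dominates.
have fE : EFin \o (fine \o f) = f by apply/funext => t /=; rewrite fineK.
exists (fine \o f); split=> [|A mA].
  by rewrite fE; exact: Radon_Nikodym_integrable weighted_charge_dominates.
apply: EFin_inj.
rewrite -[LHS]/(weighted_charge A).
rewrite (Radon_Nikodym_integral weighted_charge_dominates mA).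
rewrite -/f -fE integral_mkcond /Rintegral fineK.
  apply: eq_integral => t _; rewrite patchE indicE /=.
  by case: (t \in A); rewrite ?mul1r ?mul0r.
apply: integrable_fin_num => //.
have := Radon_Nikodym_integrable weighted_charge_dominates.
rewrite -/f -fE => intf; apply: (le_integrable _ _ _ intf) => //.
  apply/measurable_EFinP/measurable_funM => //.
  exact: integrable_measurable intf.
move=> t _ /=; rewrite lee_fin normrM ler_piMl// indicE.
by case: (t \in A); rewrite ?normr1 ?normr0.
Qed.

End Riesz.

Section FiniteSums.
Context d (T : measurableType d) (R : realType) (mu : {measure set T -> \bar R}).
Local Notation integrable f := (mu.-integrable [set: T] (EFin \o f)).

Lemma integrable_Rintegral_sum (I : Type) (s : seq I) (F : I -> T -> R) :
  (forall i, integrable (F i)) ->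
  integrable (fun t => \sum_(i <- s) F i t) /\
  \int[mu]_t (\sum_(i <- s) F i t) = \sum_(i <- s) \int[mu]_t F i t.
Proof.
move=> iF; elim: s => [|i s [IHi IH]].
  under eq_fun do rewrite big_nil; rewrite big_nil.
  by split; [exact: integrable0|rewrite /Rintegral integral0].
under eq_fun do rewrite big_cons; rewrite big_cons; split.
  exact: (integrableD measurableT (iF i) IHi).
by rewrite -IH RintegralD.
Qed.

(** Testing on the set where [f] is positive gives a nonnegative function with nonpositive integral,
    hence one that vanishes almost everywhere. *)
Lemma ae_le0_integral (f : T -> R) : integrable f ->
  (forall A, measurable A -> \int[mu]_t (\1_A t * f t) <= 0) ->
  \forall t \ae mu, f t <= 0.
Proof.
move=> intf H; pose A := [set t | 0 < f t].
have mf := integrable_measurable intf.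
have mA : measurable A.
  rewrite (_ : A = f @^-1` `]0, +oo[%classic).
    by rewrite -[X in measurable X]setTI; exact: mf.
  by apply/seteqP; split=> t /=; rewrite in_itv/= andbT.
have iA := integrable_indicM mA intf.
have A0 t : 0 <= \1_A t * f t.
  by rewrite indicE; have [/set_mem/ltW ?|_] := boolP (t \in A);
    rewrite ?mul1r ?mul0r.
have I0 : (\int[mu]_t `|(\1_A t * f t)%:E| = 0)%E.
  under eq_integral do rewrite gee0_abs ?lee_fin//.
  rewrite -[LHS]fineK; last exact: (integrable_fin_num measurableT iA).
  congr EFin; apply/eqP; rewrite eq_le (H A mA) /=.
  by apply: Rintegral_ge0 => t _.
have := (ae_eq_integral_abs mu measurableT (measurable_int _ iA)).1 I0.
apply: (@filterS _ _ (ae_filter_ringOfSetsType mu)) => t /(_ I) /=.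
rewrite indicE; case: leP => // ft.
by rewrite mem_set//= mul1r => -[ft0]; rewrite ft0 ltxx in ft.
Qed.

End FiniteSums.

(** * Functionals are determined by weighted indicators *)

Section Density.
Context d (T : measurableType d) (R : realType)
  (mu : {sigma_finite_measure set T -> \bar R}).
Local Notation integrable f := (mu.-integrable [set: T] (EFin \o f)).
Variables (g : T -> R) (g_gt0 : forall t, 0 < g t) (ig : integrable g).

Import HBNNSimple.

Lemma measurable_inv_gt0 : measurable_fun [set: T] (fun t => (g t)^-1).
Proof.
under eq_fun => t do rewrite -powR_inv1 ?(ltW (g_gt0 t))//.
apply: (measurableT_comp (measurable_powR _)) => //.
exact: integrable_measurable ig.
Qed.

Section weighted0.
Variables (C : R) (l : (T -> R) -> R).
Hypothesis lC : L1_functional mu C l.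
Hypothesis l0 : forall A, measurable A -> l (fun t => \1_A t * g t) = 0.

Lemma L1_functional_indic_sum0 (s : seq R) (A : R -> set T) :
  (forall y, measurable (A y)) ->
  let f t := (\sum_(y <- s) y * \1_(A y) t) * g t in integrable f /\ l f = 0.
Proof.
move=> mA; elim: s => [|y s [IHi IH]] /=.
  under eq_fun do rewrite big_nil mul0r.
  by split; [exact: integrable0|exact: L1_functional0 lC].
have E : (fun t => (\sum_(z <- y :: s) z * \1_(A z) t) * g t) =
    (fun t => y * (\1_(A y) t * g t) + (\sum_(z <- s) z * \1_(A z) t) * g t).
  by apply/funext => t; rewrite big_cons mulrDl mulrA.
have iA := integrable_indicM (mA y) ig.
rewrite E; split.
  exact: (integrableD measurableT (integrable_mulrl y iA) IHi).
by rewrite (L1_functional_lin lC)// l0// mulr0 add0r.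
Qed.

Lemma L1_functional_nnsfun0 (s : {nnsfun T >-> R}) : l (fun t => s t * g t) = 0.
Proof.
have [] := @L1_functional_indic_sum0 (finmap.enum_fset (fset_set (range s)))
  (fun y => s @^-1` [set y]).
  by move=> y; exact: measurable_sfunP.
move=> _ <-; congr l; apply/funext => t; congr (_ * _).
by rewrite fimfunE fsbig_finite.
Qed.

(** Simple functions approximating [f / g] from below, multiplied by [g], converge to [f] and are
    dominated by [f]; the functional vanishes on each of them. *)
Lemma L1_functional_ge0_eq0 (f : T -> R) : (forall t, 0 <= f t) ->
  integrable f -> l f = 0.
Proof.
move=> f0 intf.
have mf := integrable_measurable intf; have mg := integrable_measurable ig.
have mF : measurable_fun [set: T] (EFin \o (fun t => f t / g t)).
  by apply/measurable_EFinP/measurable_funM => //; exact: measurable_inv_gt0.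
have F0 : forall t, [set: T] t -> (0 <= (f t / g t)%:E)%E.
  by move=> t _; rewrite lee_fin; apply: divr_ge0 => //; rewrite ltW.
pose s := nnsfun_approx measurableT mF.
have sf n t : s n t * g t <= f t.
  rewrite -ler_pdivlMr// -lee_fin /s nnsfun_approxE.
  exact: (le_approx n F0).
have : l \o (fun n t => s n t * g t) @ \oo --> l f.
  apply: (L1_functional_cvg lC _ mf _ intf) => [n|t|n t].
  - by apply: measurable_funM => //; exact: measurable_sfun.
  - rewrite -[X in _ --> X](divfK (lt0r_neq0 (g_gt0 t))).
    apply: cvgMl; exact: (fine_cvg (cvg_nnsfun_approx measurableT mF F0 I)).
  - by rewrite ger0_norm// mulr_ge0// ltW.
rewrite (_ : l \o _ = fun=> 0) => [|]; first by move/cvg_lim => <-//; rewrite lim_cst.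
by apply/funext => n /=; exact: L1_functional_nnsfun0.
Qed.

Lemma L1_functional_eq0 (f : T -> R) : integrable f -> l f = 0.
Proof.
move=> intf; have mf := integrable_measurable intf.
have posn (x : R) : `|Num.max x 0| <= `|x|.
  by rewrite ger0_norm ?le_max ?lexx ?orbT// ge_max ler_norm normr_ge0.
have intp : integrable (fun t => Num.max (f t) 0).
  apply: (le_integrable _ _ _ intf) => //.
    by apply/measurable_EFinP; exact: measurable_maxr.
  by move=> t _ /=; rewrite lee_fin posn.
have intn : integrable (fun t => Num.max (- f t) 0).
  apply: (le_integrable _ _ _ intf) => //.
    by apply/measurable_EFinP; apply: measurable_maxr => //; exact: measurableT_comp.
  by move=> t _ /=; rewrite lee_fin (le_trans (posn _))// normrN.
have -> : f = (fun t => Num.max (f t) 0 - Num.max (- f t) 0).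
  apply/funext => t; case: (leP (f t) 0) => ft.
    by rewrite max_l ?oppr_ge0// opprK add0r.
  by rewrite max_r ?oppr_le0 ?subr0// ltW.
rewrite (L1_functionalB lC)// !L1_functional_ge0_eq0 ?subrr// => t.
  by rewrite le_max lexx orbT.
by rewrite le_max lexx orbT.
Qed.

End weighted0.

Lemma L1_functional_sub (C1 C2 : R) (l1 l2 : (T -> R) -> R) :
  L1_functional mu C1 l1 -> L1_functional mu C2 l2 ->
  L1_functional mu (C1 + C2) (fun f => l1 f - l2 f).
Proof.
move=> [lin1 b1] [lin2 b2]; split=> [a f h intf inth|f intf].
  by rewrite lin1// lin2// mulrBr opprD addrACA.
by rewrite mulrDl (le_trans (ler_normB _ _))// lerD ?b1 ?b2.
Qed.

Lemma eq_L1_functional (C1 C2 : R) (l1 l2 : (T -> R) -> R) :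
  L1_functional mu C1 l1 -> L1_functional mu C2 l2 ->
  (forall A, measurable A ->
    l1 (fun t => \1_A t * g t) = l2 (fun t => \1_A t * g t)) ->
  forall f, integrable f -> l1 f = l2 f.
Proof.
move=> l1C l2C l12 f intf; apply/eqP; rewrite -subr_eq0; apply/eqP.
apply: (L1_functional_eq0 (L1_functional_sub l1C l2C)) => // A mA.
by rewrite l12// subrr.
Qed.

End Density.

(** * Half-spaces *)

Section HalfSpaces.
Context (R : realType) (m : nat) (A : set 'rV[R]_m).

Lemma continuous_sqdist (x : 'rV[R]_m) :
  continuous (fun y : 'rV[R]_m => \sum_(i < m) (x 0 i - y 0 i) ^+ 2).
Proof.
move=> y.
apply: (@cvg_big _ _ _ _ _ _ _ (nbhs y) _ _ _ (nbhs_filter y)) => [|i _].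
  exact: add_continuous.
apply: (@continuous_comp _ _ _ (fun y : 'rV[R]_m => x 0 i - y 0 i)
  (fun r => r ^+ 2) y).
  apply: (@cvgB _ _ _ (nbhs y) (nbhs_filter y)).
    exact: (@cvg_cst _ _ _ (nbhs y) (nbhs_filter y)).
  exact: (@coord_continuous _ _ _ 0 i y).
exact: exprn_continuous.
Qed.

Hypotheses (A0 : A !=set0) (cA : compact A)
  (convA : convex_set (A : set (convex_lmodType 'rV[R]_m))).

(** The norm of ['rV[R]_m] is the maximum norm. The Euclidean distance is written out because the
    projection argument needs an inner product. *)
Lemma nearest_point (x : 'rV[R]_m) : exists p : 'rV[R]_m, A p /\
  forall y, A y -> \sum_(i < m) (x 0 i - p 0 i) ^+ 2 <=
                   \sum_(i < m) (x 0 i - y 0 i) ^+ 2.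
Proof.
have [|p pA pmin] := EVT_min_rV A0 cA (f := fun y => \sum_(i < m) (x 0 i - y 0 i) ^+ 2).
  by apply: continuous_subspaceT; exact: continuous_sqdist.
exists p; split; first exact: set_mem.
by move=> y Ay; apply: pmin; exact: mem_set.
Qed.

Lemma convex_set_segment (x y : 'rV[R]_m) (r : R) : 0 <= r <= 1 -> A x -> A y ->
  A (x + r *: (y - x)).
Proof.
move=> /andP[r0 r1] Ax Ay.
have ra : 0 <= 1 - r by lra.
have rb : 1 - r <= 1 by lra.
have := convA (Itv01 ra rb) (mem_set Ax) (mem_set Ay).
move/set_mem; congr A.
apply/rowP => i; rewrite /conv/= !mxE /unstable.onem; lra.
Qed.

(* Variational inequality for the projection onto a convex set: otherwise moving
   from [p] towards [y] would decrease the distance to [x]. *)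
Lemma nearest_point_obtuse (x p : 'rV[R]_m) : A p ->
  (forall y, A y -> \sum_(i < m) (x 0 i - p 0 i) ^+ 2 <=
                    \sum_(i < m) (x 0 i - y 0 i) ^+ 2) ->
  forall y, A y -> \sum_(i < m) (x 0 i - p 0 i) * (y 0 i - p 0 i) <= 0.
Proof.
move=> Ap pmin y Ay; rewrite leNgt; apply/negP.
set s := \sum_(i < m) _ => s0.
pose N : R := \sum_(i < m) (y 0 i - p 0 i) ^+ 2.
have N0 : 0 <= N by apply: sumr_ge0 => i _; exact: sqr_ge0.
(* Expand the square distance from [x] to [p + r *: (y - p)] and compare it with the minimum. *)
have key (r : R) : 0 <= r <= 1 -> 2 * r * s <= r ^+ 2 * N.
  move=> r01; have := pmin _ (convex_set_segment r01 Ap Ay).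
  rewrite -subr_ge0 -sumrB => h.
  rewrite -subr_ge0 /s /N !mulr_sumr -sumrB; apply: le_trans h _.
  by apply: ler_sum => i _; rewrite !mxE; lra.
(* This makes [r * N <= s], whereas [key] divided by [r] gives [2 * s <= r * N]. *)
pose r := Num.min 1 (s / (N + 1)).
have N1 : 0 < N + 1 by lra.
have r0 : 0 < r by rewrite lt_min ltr01 divr_gt0.
have r1 : r <= 1 by rewrite ge_min lexx.
have rs : r * (N + 1) <= s by rewrite -ler_pdivlMr// ge_min lexx orbT.
have := key r; rewrite r1 ltW// => /(_ isT).
have -> : 2 * r * s = r * (2 * s) by lra.
rewrite expr2 -mulrA ler_pM2l// => h; nra.
Qed.

Lemma rat_approx_rV (x : 'rV[R]_m) (e : R) : 0 < e ->
  exists q : 'rV[rat]_m, \sum_(i < m) (x 0 i - ratr (q 0 i)) ^+ 2 < e.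
Proof.
move=> e0.
(* As [eta <= 1], each square is at most [eta]; the added 1 gives the strict inequality and covers
   [m = 0]. *)
pose eta := Num.min 1 (e / (m%:R + 1)).
have m1 : 0 < m%:R + 1 :> R by rewrite ltr_wpDl.
have eta0 : 0 < eta by rewrite lt_min ltr01 divr_gt0.
have /(_ _)/cid-/all_sig[q qE] : forall i : 'I_m,
    exists q : rat, x 0 i - eta < ratr q < x 0 i + eta.
  move=> i; have [|q] := @rat_in_itvoo R (x 0 i - eta) (x 0 i + eta); first lra.
  by rewrite in_itv/=; exists q.
exists (\row_i q i).
apply: (@le_lt_trans _ _ (\sum_(i < m) eta)).
  apply: ler_sum => i _; rewrite mxE; have /andP[h1 h2] := qE i.
  have : eta <= 1 by rewrite ge_min lexx.
  nra.
rewrite sumr_const card_ord -mulr_natr.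
have : eta * (m%:R + 1) <= e by rewrite -ler_pdivlMr// ge_min lexx orbT.
by move: (ler0n R m); nra.
Qed.

(* A compact convex set is cut out by the half-spaces supporting it at the
   points nearest to the rational points; countability of this family allows
   membership to be tested almost everywhere. *)
Lemma compact_convex_halfspaces :
  exists (a : 'rV[rat]_m -> 'rV[R]_m) (b : 'rV[rat]_m -> R), forall z,
    A z <-> forall q, \sum_(i < m) a q 0 i * z 0 i <= b q.
Proof.
pose Q (q : 'rV[rat]_m) : 'rV[R]_m := \row_i ratr (q 0 i).
have /(_ _)/cid-/all_sig[p pP] := fun q => nearest_point (Q q).
have E q z : \sum_(i < m) (Q q - p q) 0 i * z 0 i <=
    \sum_(i < m) (Q q - p q) 0 i * p q 0 i <->
    \sum_(i < m) (Q q 0 i - p q 0 i) * (z 0 i - p q 0 i) <= 0.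
  rewrite -subr_le0 -sumrB; under eq_bigr do rewrite !mxE -mulrBr.
  by under [X in _ <-> X <= 0]eq_bigr do rewrite !mxE.
exists (fun q => Q q - p q), (fun q => \sum_(i < m) (Q q - p q) 0 i * p q 0 i) => z.
split=> [Az q|H].
  by apply/E; have [Ap pmin] := pP q; exact: nearest_point_obtuse.
apply: contrapT => nAz.
have [p0 [Ap0 p0min]] := nearest_point z.
pose del := \sum_(i < m) (z 0 i - p0 0 i) ^+ 2.
have del0 : 0 < del.
  rewrite lt_neqAle sumr_ge0 ?andbT => [|i _]; last exact: sqr_ge0.
  apply/negP => /eqP/esym/eqP; rewrite psumr_eq0 => [/allP zp|i _]; last exact: sqr_ge0.
  apply: nAz; suff -> : z = p0 by [].
  apply/rowP => i; have := zp i; rewrite mem_index_enum => /(_ isT).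
  by rewrite /= sqrf_eq0 subr_eq0 => /eqP.
(* With [D < del / 4], the bound [del <= D1 <= 2 * D + 2 * |Q q - p q|^2] forces
   [|Q q - p q|^2 > D]. The half-space at [p q] then excludes [z]. *)
have del40 : 0 < del / 4 by lra.
have [q zq] := rat_approx_rV z del40.
have /E := H q; have [Ap _] := pP q; have := p0min _ Ap; rewrite -/del.
pose D := \sum_(i < m) (z 0 i - Q q 0 i) ^+ 2.
have {}zq : D < del / 4.
  by apply: le_lt_trans zq; apply: ler_sum => i _; rewrite mxE.
set D1 := \sum_(i < m) _ ^+ 2 => delD1.
have D1le : D1 <= 2 * D + 2 * \sum_(i < m) (Q q 0 i - p q 0 i) ^+ 2.
  rewrite !mulr_sumr -big_split/=; apply: ler_sum => i _.
  by have := sqr_ge0 (z 0 i - Q q 0 i - (Q q 0 i - p q 0 i)); nra.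
(* Polarization of the inner product, with the square of [z - p q] dropped. *)
have : \sum_(i < m) (Q q 0 i - p q 0 i) * (z 0 i - p q 0 i) >=
   (\sum_(i < m) (Q q 0 i - p q 0 i) ^+ 2 - D) / 2.
  rewrite -sumrB mulr_suml; apply: ler_sum => i _.
  by have := sqr_ge0 (z 0 i - p q 0 i); nra.
lra.
Qed.

End HalfSpaces.

(** * Weak* compactness of the set of controls *)

Section UltraLimits.
Context (R : realType) (I : Type) (F : set_system I) {UF : UltraFilter F}.

(** The image of [F] contains a compact segment, so it has a cluster point, to which an ultrafilter
    must converge. *)
Lemma ultra_bounded_cvg (psi : I -> R) (c : R) : (forall x, `|psi x| <= c) ->
  exists l : R, psi @ F --> l.
Proof.
move=> psic.
have PF : ProperFilter F by exact: ultra_proper.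
have psiK : F (psi @^-1` `[- c, c]%classic).
  by apply: filterS filterT => x _ /=; rewrite in_itv/= -ler_norml.
have [l [_ cl]] := @segment_compact R (- c) c (psi @ F) _ psiK.
exists l => A lA.
have [//|nA] := in_ultra_setVsetC (psi @^-1` A) UF.
have [r [Ar nAr]] := cl (~` A) A nA lA.
by exfalso.
Qed.

(** The common constant [C] bounds the values at each integrable [f], so pointwise limits exist;
    linearity and the bound pass to the limit. *)
Lemma ultra_L1_functional d (T : measurableType d) (mu : {measure set T -> \bar R})
    (C : R) (l : I -> (T -> R) -> R) :
  (forall x, L1_functional mu C (l x)) ->
  exists L, L1_functional mu C L /\
    forall f, mu.-integrable [set: T] (EFin \o f) -> l ^~ f @ F --> L f.
Proof.
move=> lC; have PF : ProperFilter F by exact: ultra_proper.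
pose L f := lim (l ^~ f @ F).
have lL f : mu.-integrable [set: T] (EFin \o f) -> l ^~ f @ F --> L f.
  move=> intf.
  have [r lr] := @ultra_bounded_cvg (l ^~ f) _ (fun x => (lC x).2 f intf).
  by rewrite /L (cvg_lim _ lr)//; exact: Rhausdorff.
exists L; split=> //; split=> [a f g intf intg|f intf].
  apply/cvg_lim; first exact: Rhausdorff.
  under eq_fun => x do rewrite (lC x).1//.
  by apply: cvgD; [apply: cvgMr; exact: lL|exact: lL].
have nL : (fun x => `|l x f|) @ F --> `|L f| by apply: cvg_norm; exact: lL.
rewrite -(cvg_lim (@Rhausdorff R) nL); apply: limr_le; first by apply/cvg_ex; exists `|L f|.
by apply: nearW => x; exact: (lC x).2.
Qed.

End UltraLimits.

Section Control.
Context (R : realType) (m : nat) (Omega : set 'rV[R]_m).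
Local Notation mu := (@lebesgue_measure R).
Local Notation TR := (measurableTypeR R).
Local Notation integrable f := (mu.-integrable [set: TR] (EFin \o (f : TR -> R))).

Definition coord_pairing (i : 'I_m) (u : control Omega) (f : TR -> R) : R :=
  \int[mu]_(t in [set: TR]) (control_at u t 0 i * f t).

Lemma L1_integrable (y : L1 R) : integrable (y : R -> R).
Proof.
apply/integrableP; split.
  have my : measurable_fun [set: TR] ((y : R -> R) : TR -> TR).
    exact: measurable_funPT.
  exact/measurable_EFinP.
have := @Lebesgue_finite _ _ _ _ _ _ y.
by rewrite /finite_norm Lnorm1.
Qed.

Hypothesis cOmega : compact Omega.

Lemma coord_pairing_L1_functional : exists C,
  forall i u, L1_functional mu C (coord_pairing i u).
Proof.
have [C C0 OC] := compact_rV_bounded cOmega.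
exists C => i u; apply: Rintegral_mul_L1_functional; first exact: ltW.
  exact: control_at_measurable.
by apply: (ae_imp (svalP u)) => t /OC/(_ i).
Qed.

Lemma duality_pairingE (u : control Omega) (y : L1_vec R m) :
  duality_pairing (sval u) y = \sum_(i < m) coord_pairing i u (y i : R -> R).
Proof.
rewrite /duality_pairing /coord_pairing.
pose F i t := control_at u t 0 i * (y i : R -> R) t.
have iF i : integrable (F i).
  have [D D0 OD] := compact_rV_bounded cOmega.
  apply: (@integrable_ae_bounded_mul _ _ _ _ D).
  - exact: ltW.
  - exact: control_at_measurable.
  - by apply: (ae_imp (svalP u)) => t /OD/(_ i).
  - exact: L1_integrable.
apply: etrans (integrable_Rintegral_sum (index_enum 'I_m) iF).2; congr Rintegral.
by apply/funext => t; apply: eq_bigr => i _; rewrite /F mxE.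
Qed.

(** The topology is initial for a map into a space of functions with pointwise convergence, and each
    duality pairing is a finite sum of coordinate pairings. *)
Lemma control_cvg (F : set_system (control Omega)) (u : control Omega) :
  Filter F ->
  (forall i f, integrable f -> coord_pairing i ^~ f @ F --> coord_pairing i u f) ->
  F --> u.
Proof.
move=> FF H A [/= B [[W oW <-] Wu] BA].
apply: filterS BA _.
have Hy y : (fun v : control Omega => duality_pairing (sval v) y) @ F -->
    duality_pairing (sval u) y.
  rewrite duality_pairingE; under eq_fun do rewrite duality_pairingE.
  apply: cvg_big => [|i _]; first exact: add_continuous.
  by apply: H; exact: L1_integrable.
have Fu : @as_functional R m Omega @ F --> as_functional u.
  apply/cvg_sup => y D [/= D' [[W' oW' <-] W'u]] D'D.
  apply: filterS D'D _; apply: (Hy y); exact: open_nbhs_nbhs.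
by apply: Fu; exact: open_nbhs_nbhs.
Qed.

End Control.

Lemma normal_pdf_gt0 (R : realType) (t : R) : 0 < normal_pdf 0 1 t.
Proof.
rewrite normal_pdfE ?oner_neq0//; apply: mulr_gt0; last exact: expR_gt0.
by rewrite normal_peak_gt0 ?oner_neq0.
Qed.

Lemma convergent_combination_le (R : realType) (T : Type) (F : set_system T)
    (PF : ProperFilter F) (m : nat) (a : 'I_m -> R) (psi : 'I_m -> T -> R)
    (l : 'I_m -> R) (b : R) :
  (forall i, psi i @ F --> l i) ->
  (forall x, \sum_(i < m) a i * psi i x <= b) -> \sum_(i < m) a i * l i <= b.
Proof.
move=> psil psib.
have cv : (fun x => \sum_(i < m) a i * psi i x) @ F --> \sum_(i < m) a i * l i.
  apply: cvg_big => [|i _]; first exact: add_continuous.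
  exact: cvgMr.
rewrite -(cvg_lim (@Rhausdorff R) cv); apply: limr_le.
  by apply/cvg_ex; eexists; exact: cv.
exact: nearW.
Qed.

Lemma ae_eq_Rintegral d (T : measurableType d) (R : realType)
    (mu : {measure set T -> \bar R}) (f g : T -> R) :
  measurable_fun [set: T] f -> measurable_fun [set: T] g ->
  (\forall t \ae mu, f t = g t) -> \int[mu]_t f t = \int[mu]_t g t.
Proof.
move=> mf mg fg; rewrite /Rintegral; congr fine.
apply: ae_eq_integral => //; [exact/measurable_EFinP|exact/measurable_EFinP|].
move: fg; apply: (@filterS _ _ (ae_filter_ringOfSetsType mu)) => t fgt _.
by rewrite fgt.
Qed.

Lemma ae_Rintegral_ge0 d (T : measurableType d) (R : realType)
    (mu : {measure set T -> \bar R}) (f : T -> R) :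
  measurable_fun [set: T] f -> (\forall t \ae mu, 0 <= f t) ->
  0 <= \int[mu]_t f t.
Proof.
move=> mf f0; rewrite (@ae_eq_Rintegral _ _ _ _ _ (fun t => `|f t|))//.
- by apply: Rintegral_ge0 => t _.
- exact: measurableT_comp.
- move: f0; apply: (@filterS _ _ (ae_filter_ringOfSetsType mu)) => t f0.
  by rewrite ger0_norm.
Qed.

Lemma ae_forall_countable (R : realType) (I : countType) (P : I -> R -> Prop) :
  (forall i, \forall t \ae @lebesgue_measure R, P i t) ->
  \forall t \ae @lebesgue_measure R, forall i, P i t.
Proof.
move=> aP.
pose Q n t := if @unpickle I n is Some i then P i t else True.
have aQ : \forall t \ae @lebesgue_measure R, forall n, Q n t.
  apply: ae_foralln => n; rewrite /Q; case: unpickle => [i|]; first exact: aP.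
  exact: aeW.
by apply: (ae_imp aQ) => t Qt i; have := Qt (pickle i); rewrite /Q pickleK.
Qed.

Section ControlCompact.
Context (R : realType) (m : nat) (Omega : set 'rV[R]_m).
Local Notation mu := (@lebesgue_measure R).
Local Notation TR := (measurableTypeR R).
Local Notation integrable f := (mu.-integrable [set: TR] (EFin \o (f : TR -> R))).
Hypotheses (cOmega : compact Omega) (Omega0 : Omega !=set0)
  (convOmega : convex_set (Omega : set (convex_lmodType 'rV[R]_m))).

Let g : TR -> R := normal_pdf 0 1.
Let g_gt0 t : 0 < g t. Proof. exact: normal_pdf_gt0. Qed.
Let ig : integrable g. Proof. exact: integrable_normal_pdf. Qed.

(** The condition [f t <= 0] is the half-space inequality for [h / g] multiplied by [g]. *)
Lemma combination_integral (A : set TR) (a : 'I_m -> R) (b : R)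
    (h : 'I_m -> TR -> R) : measurable A -> (forall i, integrable (h i)) ->
  let f t := \sum_(i < m) a i * h i t - b * g t in
  integrable f /\ \int[mu]_(t in [set: TR]) (\1_A t * f t) =
   \sum_(i < m) a i * \int[mu]_(t in [set: TR]) (\1_A t * h i t) -
     b * \int[mu]_(t in [set: TR]) (\1_A t * g t).
Proof.
move=> mA ih /=.
have [isum _] := integrable_Rintegral_sum (index_enum 'I_m)
  (fun i => integrable_mulrl (a i) (ih i)).
have ibg := integrable_mulrl b ig.
split; first exact: (integrableB measurableT isum ibg).
have [isum2 sumE] := integrable_Rintegral_sum (index_enum 'I_m)
  (fun i => integrable_mulrl (a i) (integrable_indicM mA (ih i))).
have E : (fun t => \1_A t * (\sum_(i < m) a i * h i t - b * g t)) =
  (fun t => \sum_(i < m) a i * (\1_A t * h i t) - b * (\1_A t * g t)).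
  apply/funext => t; rewrite mulrBr mulr_sumr; congr (_ - _); last by rewrite mulrCA.
  by apply: eq_bigr => i _; rewrite mulrCA.
apply: etrans (congr1 (Rintegral mu [set: TR]) E) _.
rewrite RintegralB//; last first.
  exact: integrable_mulrl (integrable_indicM mA ig).
rewrite sumE RintegralZl//; last exact: integrable_indicM.
congr (_ - _); apply: eq_bigr => i _; rewrite RintegralZl//.
exact: integrable_indicM.
Qed.

Theorem control_compact : compact [set: control Omega].
Proof.
rewrite compact_ultra => F UF _.
have PF : ProperFilter F by exact: ultra_proper.
have [C lC] := coord_pairing_L1_functional cOmega.
have /(_ _)/cid-/all_sig[L LP] := fun i => @ultra_L1_functional _ _ F UF _ _ _ _ _ (lC i).
have /(_ _)/cid-/all_sig[h hP] :=
  fun i => weighted_representation g_gt0 ig (LP i).1.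
have [a [b OE]] := compact_convex_halfspaces Omega0 cOmega convOmega.
(* Each control satisfies the half-space inequality almost everywhere. Integrated against
   [\1_A * g], it passes to the limit along [F], and [A] is arbitrary. *)
have hb q : \forall t \ae mu, \sum_(i < m) a q 0 i * h i t - b q * g t <= 0.
  apply: ae_le0_integral => [|A mA].
    exact: (combination_integral (a q 0) (b q) measurableT (fun i => (hP i).1)).1.
  rewrite (combination_integral (a q 0) (b q) mA (fun i => (hP i).1)).2 subr_le0.
  under eq_bigr => i _ do rewrite -(hP i).2//.
  apply: (convergent_combination_le PF
    (psi := fun i v => coord_pairing i v (fun t => \1_A t * g t))).
    by move=> i; apply: (LP i).2; exact: integrable_indicM.
  move=> v.
  have iAg := integrable_indicM mA ig.
  have ivA i : integrable (fun t => control_at v t 0 i * (\1_A t * g t)).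
    have [D D0 OD] := compact_rV_bounded cOmega.
    apply: (@integrable_ae_bounded_mul _ _ _ _ D) => //.
    - exact: ltW.
    - exact: control_at_measurable.
    - by apply: (ae_imp (svalP v)) => t /OD/(_ i).
  have [isum sumE] := integrable_Rintegral_sum (index_enum 'I_m)
    (fun i => integrable_mulrl (a q 0 i) (ivA i)).
  under eq_bigr => i _ do rewrite /coord_pairing -RintegralZl//.
  rewrite -sumE -RintegralZl// -subr_ge0 -RintegralB//; last first.
    exact: integrable_mulrl.
  apply: ae_Rintegral_ge0.
    apply: integrable_measurable.
    exact: (integrableB measurableT (integrable_mulrl (b q) iAg) isum).
  apply: (ae_imp (svalP v)) => t /OE/(_ q) vt.
  have -> : \sum_(i < m) a q 0 i * (control_at v t 0 i * (\1_A t * g t)) =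
      (\sum_(i < m) a q 0 i * control_at v t 0 i) * (\1_A t * g t).
    by rewrite mulr_suml; apply: eq_bigr => i _; rewrite mulrA.
  rewrite -mulrBl mulr_ge0 ?subr_ge0//; apply: mulr_ge0; last exact: ltW.
  by rewrite indicE.
have hO : \forall t \ae mu, Omega (\row_i (h i t / g t)).
  apply: (ae_imp (ae_forall_countable hb)) => t H; apply/OE => q.
  have := H q; rewrite subr_le0 -ler_pdivrMr// mulr_suml.
  by congr (_ <= _); apply: eq_bigr => i _; rewrite mxE mulrA.
have mw i : measurable_fun [set: TR] ((fun t => h i t / g t) : TR -> TR).
  apply: measurable_funM; first exact: integrable_measurable (hP i).1.
  exact: measurable_inv_gt0 ig.
have [u uE] := control_of cOmega mw hO.
exists u; split=> //; apply: control_cvg => // i f intf.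
(* Since [u] equals [h / g] almost everywhere, both functionals agree on weighted indicators, hence
   on all integrable functions. *)
suff -> : coord_pairing i u f = L i f by exact: (LP i).2.
apply: (eq_L1_functional g_gt0 ig (lC i u) (LP i).1) => // A mA.
have m1 := integrable_measurable (integrable_indicM mA ig).
have mh := integrable_measurable (integrable_indicM mA (hP i).1).
rewrite (hP i).2//; apply: ae_eq_Rintegral => //.
  by apply: measurable_funM => //; exact: control_at_measurable.
apply: (ae_imp uE) => t ->; rewrite mxE mulrCA; congr (_ * _).
by rewrite divfK// lt0r_neq0.
Qed.

End ControlCompact.

(** * Chains *)

Section Metric.
Context (R : realType) (X : topologicalType) (d : X -> X -> R).
Hypothesis hd : compatible_metric d.

Lemma compatible_metric_refl x : d x x = 0.
Proof. by have [[dxy _ _] _] := hd; exact/dxy. Qed.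

Lemma compatible_metric_sym x y : d x y = d y x.
Proof. by have [[]] := hd. Qed.

Lemma compatible_metric_triangle x y z : d x z <= d x y + d y z.
Proof. by have [[]] := hd. Qed.

Lemma compatible_metric_ge0 x y : 0 <= d x y.
Proof.
have := compatible_metric_triangle x y x.
rewrite compatible_metric_refl (compatible_metric_sym y x); lra.
Qed.

Lemma compatible_metric_near x (e : R) : 0 < e -> \forall y \near x, d x y < e.
Proof. by move=> e0; apply/(hd.2 x); exists e. Qed.

End Metric.

(** * Tolerances depending on the state only *)

Section Tube.
Context (R : realType) (U X : topologicalType) (d : X -> X -> R).
Hypotheses (hd : compatible_metric d) (cU : compact [set: U]).

(* The largest 1-Lipschitz minorant of [eps (u, _)], uniform in [u]; compactness
   of [U] makes it positive. *)
Lemma uniform_positive_continuous_minorant (u0 : U) (eps : U * X -> R) :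
  positive_continuous eps ->
  exists delta : X -> R, positive_continuous delta /\
    forall u x, delta x <= eps (u, x).
Proof.
move=> [ceps eps0].
pose V x := [set r | exists u y, r = eps (u, y) + d x y].
pose delta x := inf (V x).
have V0 x : V x !=set0 by exists (eps (u0, x) + d x x), u0, x.
have lbV x : has_lbound (V x).
  by exists 0 => _ [u [y ->]]; rewrite addr_ge0 ?(ltW (eps0 _)) ?(compatible_metric_ge0 hd).
have delta_le x u y : delta x <= eps (u, y) + d x y.
  by apply: ge_inf => //; exists u, y.
have lip x y : delta x <= delta y + d x y.
  rewrite -lerBlDr; apply: lb_le_inf => // _ [u [z ->]].
  have := delta_le x u z; have := compatible_metric_triangle hd x y z; lra.
exists delta; split; [split|]; last first.
- by move=> u x; have := delta_le x u x; rewrite (compatible_metric_refl hd) addr0.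
- move=> x.
  (* Compactness in near-covering form: one positive [r] and one neighborhood of [x] serve all [u]
     at once. *)
  have H : \forall p \near filter_prod 0^'+ (nbhs x),
      [set: U] `<=` (fun u => p.1 < eps (u, p.2)).
    have := (compact_near_coveringP [set: U]).1 cU (R * X)%type
      (filter_prod 0^'+ (nbhs x)) (fun p u => p.1 < eps (u, p.2)) _.
    apply=> u _.
    pose c := eps (u, x) / 2.
    have c0 : 0 < c by rewrite divr_gt0.
    have cE : c < eps (u, x) by rewrite /c; have := eps0 (u, x); lra.
    have := ceps (u, x) [set r | c < r] (lt_nbhsr cE).
    move=> [[A1 B1] [/= uA1 xB1] AB1].
    exists (A1, [set p | p.1 < c /\ B1 p.2]).
      split=> //=; exists ([set r | r < c], B1) => //=; split=> //.
      exact: nbhs_right_lt.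
    move=> [u' [r y]] [/= Au' [rc By]]; apply: lt_trans rc _.
    by apply: (AB1 (u', y)); split.
  have [[A B] [/= A0 Bx] AB] := H.
  have [r [r0 Ar]] : exists r, 0 < r /\ A r.
    have [r [Ar r0]] := filter_ex (filterI A0 (nbhs_right_gt (0 : R))).
    by exists r.
  have [e e0 eB] := (hd.2 x B).1 Bx.
  (* Points [y] within [e] of [x] contribute at least [r] through [eps]; the others contribute at
     least [e] through the distance. *)
  apply: (@lt_le_trans _ _ (Num.min r e)); first by rewrite lt_min r0.
  apply: lb_le_inf => // _ [u [y ->]].
  have [dxy|dxy] := ltP (d x y) e.
    have /= := AB (r, y) (conj Ar (eB _ dxy)) u I.
    by rewrite ge_min; have := compatible_metric_ge0 hd x y => ? ?; apply/orP; left; lra.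
  by rewrite ge_min; apply/orP; right; have := eps0 (u, y); lra.
- move=> x; apply/cvgrPdist_lt => e e0.
  apply: filterS (compatible_metric_near hd x e0) => y dxy.
  rewrite ltr_norml; have := lip x y; have := lip y x.
  by rewrite (compatible_metric_sym hd y x); lra.
Unshelve. all: by end_near. Qed.

End Tube.

Section Chains.
Context (R : realType) (X : Type) (d : X -> X -> R) (Phi : R -> X -> X)
  (eps : X -> R) (T : R).

Lemma flow_chain1 (s : R) x y : T <= s -> d (Phi s x) y < eps (Phi s x) ->
  flow_chain d Phi eps T x y.
Proof.
move=> Ts dxy; exists 1%N, (fun j => if j is 0 then x else y), (fun=> s).
by split=> // -[|//].
Qed.

Lemma flow_chain_trans x y z : flow_chain d Phi eps T x y ->
  flow_chain d Phi eps T y z -> flow_chain d Phi eps T x z.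
Proof.
move=> [k [a [s [k0 a0 ak H]]]] [l [b [t [l0 b0 bl G]]]].
exists (k + l)%N, (fun j => if (j < k)%N then a j else b (j - k)%N),
  (fun j => if (j < k)%N then s j else t (j - k)%N).
split=> [|||j jkl].
- by rewrite addn_gt0 k0.
- by rewrite k0.
- by rewrite ltnNge leq_addr/= addKn.
- have [jk|kj] := ltnP j k; last first.
    have -> : (j.+1 < k)%N = false by rewrite ltnNge (leq_trans kj).
    by rewrite subSn//; apply: G; rewrite ltn_subLR.
  have [Ts dj] := H j jk; split=> //.
  have [jk1|] := ltnP j.+1 k; first by [].
  move=> kj; have E : j.+1 = k by apply/eqP; rewrite eqn_leq jk.
  by rewrite E subnn b0 -ak -E.
Qed.

End Chains.

(** * Controls that agree on a long window are weak* close *)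

Section ControlTail.
Context (R : realType) (m : nat) (Omega : set 'rV[R]_m).
Local Notation mu := (@lebesgue_measure R).
Local Notation TR := (measurableTypeR R).
Hypothesis cOmega : compact Omega.

(** Otherwise some sequence of controls agrees with [u] on growing windows but avoids [A]. It
    converges to [u], because controls are uniformly bounded and an integrable function has small
    tails. *)
Lemma nbhs_control_window (u : control Omega) (A : set (control Omega)) :
  nbhs u A -> exists N : nat, forall w : control Omega,
    (\forall t \ae mu, - N%:R < t < N%:R -> control_at w t = control_at u t) ->
    A w.
Proof.
move=> uA; apply: contrapT => /forallNP H.
have /(_ _)/cid-/all_sig[w wP] : forall N : nat, exists w : control Omega,
    (\forall t \ae mu, - N%:R < t < N%:R -> control_at w t = control_at u t) /\
    ~ A w.
  by move=> N; have /existsNP[w /not_implyP] := H N; exists w.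
have wu : w @ \oo --> u.
  apply: control_cvg => // i f intf.
  have [C lC] := coord_pairing_L1_functional cOmega.
  pose B (n : nat) : set TR := `]- n%:R, n%:R[%classic.
  have mB n : measurable (B n) by exact: measurable_itv.
  pose f_ n t := \1_(~` B n) t * f t.
  have mf_ n : measurable_fun [set: TR] (f_ n).
    apply: measurable_funM; last exact: integrable_measurable intf.
    by apply: measurable_indic; exact: measurableC.
  have if_ n : mu.-integrable [set: TR] (EFin \o f_ n).
    by apply: integrable_indicM => //; exact: measurableC.
  (* The factor 2 accounts for the pairings of both [u] and [w n] with the tail [f_ n]. *)
  have f_0 : (fun n => 2 * C * \int[mu]_t `|f_ n t|) @ \oo --> 0.
    (* The integral itself, viewed as a functional so that [L1_functional_cvg] applies. *)
    pose l (h : TR -> R) := \int[mu]_(t in [set: TR]) (1 * h t).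
    have l1 : L1_functional mu 1 l.
      apply: Rintegral_mul_L1_functional => //.
      by apply: aeW => t; rewrite normr1.
    have lf : l \o (fun n t => `|f_ n t|) @ \oo --> l (fun=> 0).
      apply: (L1_functional_cvg l1 _ _ _ (integrable_norm intf)) => [n||t|n t].
      - exact: measurableT_comp.
      - exact: measurable_cst.
      - apply: cvg_near_cst; near=> n.
        have Bt : B n t.
          by rewrite /B/= in_itv/= -ltr_norml; near: n; exact: nbhs_infty_gtr.
        by rewrite /f_ indicE memNset ?mul0r ?normr0//; exact.
      - rewrite normr_id /f_ normrM ler_piMl// indicE.
        by case: (_ \in _); rewrite ?normr1 ?normr0.
    have -> : (fun n => 2 * C * \int[mu]_t `|f_ n t|) =
        (fun n => 2 * C * (l \o (fun n t => `|f_ n t|)) n).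
      by apply/funext => n; congr (_ * _); apply: eq_Rintegral => t _; rewrite mul1r.
    rewrite -[X in _ --> X](mulr0 (2 * C)) -(L1_functional0 l1); exact: cvgMr.
  apply/cvgrPdist_le => e e0; move/cvgrPdist_le : f_0 => /(_ e e0).
  apply: filterS => n; rewrite sub0r normrN => h; apply: le_trans h.
  apply: le_trans (ler_norm _).
  have fE : f = (fun t => 1 * (\1_(B n) t * f t) + f_ n t).
    apply/funext => t; rewrite mul1r /f_ -mulrDl !indicE in_setC.
    by case: (_ \in _); rewrite /= ?addr0 ?add0r mul1r.
  have iB : mu.-integrable [set: TR] (EFin \o (fun t => \1_(B n) t * f t)).
    exact: integrable_indicM.
  have split_ (v : control Omega) : coord_pairing i v f =
      coord_pairing i v (fun t => \1_(B n) t * f t) + coord_pairing i v (f_ n).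
    by rewrite {1}fE (lC i v).1// mul1r.
  rewrite !split_.
  have -> : coord_pairing i (w n) (fun t => \1_(B n) t * f t) =
      coord_pairing i u (fun t => \1_(B n) t * f t).
    have mBf := integrable_measurable iB.
    apply: ae_eq_Rintegral.
    - by apply: measurable_funM => //; exact: control_at_measurable.
    - by apply: measurable_funM => //; exact: control_at_measurable.
    apply: (ae_imp (wP n).1) => t Ht.
    rewrite indicE; have [/set_mem|_] := boolP (t \in B n); last by rewrite !mul0r !mulr0.
    by rewrite /B/= in_itv/= => /Ht ->.
  rewrite opprD addrACA subrr add0r (le_trans (ler_normB _ _))//.
  have := (lC i u).2 _ (if_ n); have := (lC i (w n)).2 _ (if_ n).
  by rewrite -mulrA; lra.
have [N _ NA] := wu _ uA.
exact: (wP N).2 (NA N (leqnn N)).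
Unshelve. all: by end_near. Qed.

End ControlTail.

(** * Lifting controlled chains and projecting flow chains *)

Section Lift.
Context (R : realType) (n m : nat) (M : topologicalType)
  (S : smooth_manifold R n M) (dM : M -> M -> R) (hdM : compatible_metric dM)
  (X0 : smooth_vector_field S) (X : 'I_m -> smooth_vector_field S)
  (Omega : set 'rV[R]_m)
  (convOmega : convex_set (Omega : set (convex_lmodType 'rV[R]_m)))
  (cOmega : compact Omega) (Omega0 : Omega !=set0)
  (dU : control Omega -> control Omega -> R) (hdU : compatible_metric dU)
  (hsolvable : forall (u : control Omega) (x0 : M),
     exists! x : R -> M, is_trajectory X0 X u x /\ x 0 = x0)
  (phi : R -> M -> control Omega -> M)
  (hphi : forall (u : control Omega) (x0 : M),
     is_trajectory X0 X u (fun t => phi t x0 u) /\ phi 0 x0 u = x0).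
Local Notation mu := (@lebesgue_measure R).
Local Notation Phi := (control_flow phi).
Local Notation d := (max_metric dU dM).
Implicit Types (u v w p f : control Omega) (x y : M).

Let cocycle := flow_cocycle hsolvable hphi.

(* The control components of consecutive links are successive shifts of a single
   concatenated control, so the chain only jumps in the state component. *)
Lemma controlled_chain_lift (eps : control Omega * M -> R) (delta : M -> R)
    (T : R) : 0 < T -> (forall q, 0 < eps q) ->
  (forall u x, delta x <= eps (u, x)) ->
  forall k (z : nat -> M) (s : nat -> R) (c : nat -> control Omega) p f,
  (forall j, (j < k)%N -> T <= s j /\
     dM (phi (s j) (z j) (c j)) (z j.+1) < delta (phi (s j) (z j) (c j))) ->
  exists w w' : control Omega,
    [/\ \forall t \ae mu, t < 0 -> control_at w t = control_at p t,
        \forall t \ae mu, 0 <= t -> control_at w' t = control_at f t &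
        (k = 0%N /\ w = w') \/ flow_chain d Phi eps T (w, z 0%N) (w', z k)].
Proof.
move=> T0 eps0 delta_eps; elim => [|k IH] z s c p f H.
  have [w wE] := control_concat 0 p f cOmega.
  exists w, w; split; last by left.
    by apply: (ae_imp wE) => t -> ->.
  by apply: (ae_imp wE) => t ->; case: ltP.
have [p0 p0E] := control_concat 0 p (c 0%N) cOmega.
(* The past prescribed for the remaining links is [p] followed by [c 0] on [[0, s 0)]. Shifting [w1]
   back by [s 0] thus yields a control that starts with the first link. *)
have [|w1 [w' [w1E w'E chain1]]] := IH (fun j => z j.+1) (fun j => s j.+1)
  (fun j => c j.+1) (shift_control (s 0%N) p0) f.
  by move=> j jk; exact: H.
have [Ts jump] := H 0%N isT.
have s0 : 0 <= s 0%N by lra.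
pose w := shift_control (- s 0%N) w1.
have wE : \forall t \ae mu, t < s 0%N -> control_at w t = control_at p0 t.
  have E1 := ae_translation (- s 0%N) w1E.
  have E2 := ae_translation (- s 0%N) (shift_controlE (s 0%N) p0).
  have E3 := shift_controlE (- s 0%N) w1.
  apply: (ae_imp2 (ae_imp2 E1 E2 (fun _ h1 h2 => conj h1 h2)) E3) => t.
  move=> [h1 h2] h3 ts; rewrite h3 h1 ?h2 ?addNKr//; lra.
have w1w : shift_control (s 0%N) w = w1.
  by rewrite shift_control_comp subrr shift_control0.
have phiw : phi (s 0%N) (z 0%N) w = phi (s 0%N) (z 0%N) (c 0%N).
  have agree : \forall t \ae mu,
      0 <= t < s 0%N -> control_at w t = control_at (c 0%N) t.
    apply: (ae_imp2 wE p0E) => t h1 h2 /andP[t0 ts].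
    by rewrite h1// h2 ltNge t0.
  exact: (flow_causal cOmega hsolvable hphi _ s0 agree).
have link : flow_chain d Phi eps T (w, z 0%N) (w1, z 1%N).
  apply: (flow_chain1 Ts); rewrite /control_flow/= w1w phiw /max_metric/=.
  rewrite (compatible_metric_refl hdU) gt_max eps0/=.
  exact: lt_le_trans jump (delta_eps _ _).
exists w, w'; split=> //.
  apply: (ae_imp2 wE p0E) => t h1 h2 t0.
  by rewrite h1 ?h2 ?t0//; lra.
right; case: chain1 => [[k0 <-]|]; first by rewrite k0.
exact: flow_chain_trans.
Qed.

(** The chain runs from [(u, x)] through [(w0, xT)], [(w, x2)] and [(w', y0)] to [(v, y)]. The first
    and last links jump in the control only, the second does not jump, and the middle part lifts a
    controlled chain. *)
Lemma control_lift_chain_transitive (E : set M) :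
  chain_control_property dM phi E ->
  strongly_chain_transitive d Phi (control_lift phi E).
Proof.
move=> [chainE _] [u x] [v y] /= ux vy T T0 eps heps.
have [ceps eps0] := heps.
have cU := control_compact cOmega Omega0 convOmega.
have [delta [hdelta delta_eps]] :=
  uniform_positive_continuous_minorant hdM cU u heps.
pose uT := shift_control T u; pose xT := phi T x u.
(* The tolerance of the first jump is taken at [(uT, xT)], which is fixed before [N] is chosen;
   [N >= T] makes the second link long enough. *)
have [N1 N1P] := nbhs_control_window cOmega (compatible_metric_near hdU uT (eps0 (uT, xT))).
pose N : R := Num.max N1%:R T.
have NN1 : N1%:R <= N by rewrite le_max lexx.
have TN : T <= N by rewrite le_max lexx orbT.
(* The last tolerance is taken at the still unknown [(w, y)]; by continuity it stays above half of
   [eps (v, y)]. *)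
have near_v : \forall w \near v, dU w v < eps (w, y).
  have e0 : 0 < eps (v, y) / 2 by rewrite divr_gt0.
  have elt : eps (v, y) / 2 < eps (v, y) by have := eps0 (v, y); lra.
  have [[A B] [/= vA yB] AB] := ceps (v, y) [set r | eps (v, y) / 2 < r] (lt_nbhsr elt).
  have dv := compatible_metric_near hdU v e0.
  have {}vA : \forall w \near v, A w by [].
  apply: filterS2 vA dv => w Aw; rewrite (compatible_metric_sym hdU) => /lt_trans; apply.
  by apply: (AB (w, y)); split=> //; exact: nbhs_singleton.
have [N2 N2P] := nbhs_control_window cOmega near_v.
pose N' : R := Num.max N2%:R T.
have NN2 : N2%:R <= N' by rewrite le_max lexx.
have TN' : T <= N' by rewrite le_max lexx orbT.
have N0 : 0 <= N by lra.
have N'0 : 0 <= N' by lra.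
(* These lie on the given trajectories at times [T + N] and [- N'], hence in [E]. *)
pose x2 := phi N xT uT; pose y0 := phi (- N') y v.
have Ex2 : E x2 by rewrite /x2 -cocycle.
have [k [z [s [c [k0 z0 zk H]]]]] := chainE x2 y0 Ex2 (vy _) delta hdelta T T0.
have [w [w' [wE w'E]]] := controlled_chain_lift T0 eps0 delta_eps
  (shift_control N uT) (shift_control (- N') v) H.
rewrite z0 zk => -[[k00 _]|chain]; first by rewrite k00 in k0.
pose w0 := shift_control (- N) w.
have w0E : \forall t \ae mu, t < N -> control_at w0 t = control_at uT t.
  have E1 := ae_translation (- N) wE.
  have E2 := ae_translation (- N) (shift_controlE N uT).
  have E3 := shift_controlE (- N) w.
  apply: (ae_imp2 (ae_imp2 E1 E2 (fun _ h1 h2 => conj h1 h2)) E3) => t.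
  move=> [h1 h2] h3 tN; rewrite h3 h1 ?h2 ?addNKr//; lra.
have w0w : shift_control N w0 = w.
  by rewrite shift_control_comp subrr shift_control0.
have phiw0 : phi N xT w0 = x2.
  have agree : \forall t \ae mu,
      0 <= t < N -> control_at w0 t = control_at uT t.
    by apply: (ae_imp w0E) => t h1 /andP[t0 tN]; exact: h1.
  exact: (flow_causal cOmega hsolvable hphi _ N0 agree).
pose w2 := shift_control N' w'.
have w2E : \forall t \ae mu, - N' <= t -> control_at w2 t = control_at v t.
  have E1 := ae_translation N' w'E.
  have E2 := ae_translation N' (shift_controlE (- N') v).
  have E3 := shift_controlE N' w'.
  apply: (ae_imp2 (ae_imp2 E1 E2 (fun _ h1 h2 => conj h1 h2)) E3) => t.
  move=> [h1 h2] h3 tN; rewrite h3 h1 ?h2 ?addKr//; lra.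
have phiw' : phi N' y0 w' = y.
  have -> : phi N' y0 w' = phi N' y0 (shift_control (- N') v).
    have agree : \forall t \ae mu, 0 <= t < N' ->
        control_at w' t = control_at (shift_control (- N') v) t.
      by apply: (ae_imp w'E) => t h1 /andP[t0 tN]; exact: h1.
    exact: (flow_causal cOmega hsolvable hphi _ N'0 agree).
  by rewrite -cocycle addNr (flow0 hphi).
have link1 : flow_chain d Phi eps T (u, x) (w0, xT).
  apply: (flow_chain1 (lexx T)).
  rewrite /control_flow/= /max_metric/= (compatible_metric_refl hdM) gt_max eps0 andbT.
  apply: N1P; apply: (ae_imp w0E) => t h /andP[_ tN]; apply: h.
  exact: lt_le_trans NN1.
have link2 : flow_chain d Phi eps T (w0, xT) (w, x2).
  apply: (flow_chain1 TN).
  rewrite /control_flow/= w0w phiw0 /max_metric/=.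
  by rewrite (compatible_metric_refl hdM) (compatible_metric_refl hdU) maxxx.
have link3 : flow_chain d Phi eps T (w', y0) (v, y).
  apply: (flow_chain1 TN').
  rewrite /control_flow/= phiw' /max_metric/= (compatible_metric_refl hdM) gt_max eps0 andbT.
  apply: N2P; apply: (ae_imp w2E) => t h /andP[tN _]; apply: h; lra.
exact: flow_chain_trans (flow_chain_trans link1 link2) (flow_chain_trans chain link3).
Qed.

Lemma control_lift_invariant (E : set M) :
  flow_invariant Phi (control_lift phi E).
Proof.
by move=> t _ [[u x] /= ux <-] r /=; rewrite -cocycle.
Qed.

Lemma state_projection_chain_control (Z : set (control Omega * M)) :
  flow_invariant Phi Z -> strongly_chain_transitive d Phi Z ->
  chain_control_property dM phi (state_projection Z).
Proof.
move=> invZ chainZ; split=> [x y [u ux] [v vy] eps [ceps eps0] T T0|x [u ux]].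
  have [|k [z [s [k0 z0 zk H]]]] := chainZ _ _ ux vy T T0 (eps \o snd).
    split=> [q|q]; last exact: eps0.
    by apply: continuous_comp; [exact: cvg_snd|exact: ceps].
  exists k, (fun j => (z j).2), s, (fun j => (z j).1).
  split=> [|||j jk]; rewrite ?z0 ?zk//.
  have [Ts] := H j jk; rewrite /max_metric gt_max => /andP[_ dlt].
  by split.
by exists u => t; exists (shift_control t u); apply: (invZ t); exists (u, x).
Qed.

(** Invariance keeps whole orbits in [Z], hence their trajectories in the projection. Both
    maximality arguments rest on this inclusion. *)
Lemma invariant_sub_control_lift (Z : set (control Omega * M)) :
  flow_invariant Phi Z -> Z `<=` control_lift phi (state_projection Z).
Proof.
move=> invZ [u x] Zux t; exists (shift_control t u).
by apply: (invZ t); exists (u, x).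
Qed.

End Lift.

(** * Transfer of maximality between the two kinds of sets *)

Theorem theorem5 (R : realType) (n m : nat)
  (M : topologicalType) (S : smooth_manifold R n M)
  (dM : M -> M -> R) (hdM : compatible_metric dM)
  (X0 : smooth_vector_field S) (X : 'I_m -> smooth_vector_field S)
  (Omega : set 'rV[R]_m)
  (hconvex : convex_set (Omega : set (convex_lmodType 'rV[R]_m)))
  (hcompact : compact Omega) (hnbhs : nbhs (0 : 'rV[R]_m) Omega)
  (dU : control Omega -> control Omega -> R) (hdU : compatible_metric dU)
  (hsolvable : forall (u : control Omega) (x0 : M),
     exists! x : R -> M, is_trajectory X0 X u x /\ x 0 = x0)
  (phi : R -> M -> control Omega -> M)
  (hphi : forall (u : control Omega) (x0 : M),
     is_trajectory X0 X u (fun t => phi t x0 u) /\ phi 0 x0 u = x0) :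
  (forall E : set M, strong_chain_control_set dM phi E ->
     maximal_invariant_strongly_chain_transitive
       (max_metric dU dM) (control_flow phi) (control_lift phi E)) /\
  (forall E : set (control Omega * M), E !=set0 ->
     maximal_invariant_strongly_chain_transitive
       (max_metric dU dM) (control_flow phi) E ->
     strong_chain_control_set dM phi (state_projection E)).
Proof.
have Omega0 : Omega !=set0 by exists 0; exact: nbhs_singleton.
have liftE E : chain_control_property dM phi E ->
    flow_invariant (control_flow phi) (control_lift phi E) /\
    strongly_chain_transitive (max_metric dU dM) (control_flow phi)
      (control_lift phi E).
  move=> HE; split; first exact: (control_lift_invariant hsolvable hphi).
  exact: (control_lift_chain_transitive hdM hconvex hcompact Omega0 hdU
    hsolvable hphi HE).
split=> E.
- move=> [_ [HE maxE]]; split; first exact: liftE.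
  move=> Z [invZ chainZ] EZ; apply/seteqP; split=> //.
  (* Each point of [E] has a control keeping it in [E], so the projection of the competitor [Z]
     contains [E], and maximality of [E] applies. *)
  have projE : state_projection Z = E.
    apply: maxE; first exact: state_projection_chain_control invZ chainZ.
    move=> x Ex; have [u xu] := HE.2 x Ex; exists u; apply: EZ => t /=.
    exact: xu.
  by rewrite -projE; exact: invariant_sub_control_lift.
- move=> [[u x] Eux] [[invE chainE] maxE]; split; first by exists x, u.
  split; first exact: state_projection_chain_control invE chainE.
  move=> F HF EF; apply/seteqP; split=> //.
  (* The lift of the competitor [F] contains [E], so they coincide; every point of [F] is the state
     of a lifted point. *)
  have liftF : control_lift phi F = E.
    apply: maxE; first exact: liftE.
    by move=> q /(invariant_sub_control_lift invE) Eq t; apply: EF; exact: Eq.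
  move=> y Fy; have [v yv] := HF.2 y Fy; exists v.
  by rewrite -liftF.
Qed.
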